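(* Let $n$ be an even positive integer and consider the Hamiltonian system $\dot{\mathbf Z}(t)=\mathcal J_{\mathbb R^{2n}}\nabla H_{\mathbb R^{2n}}(\mathbf Z(t))$ on $\mathbb R^{2n}\setminus\Delta$ with Hamiltonian $$H_{\mathbb R^{2n}}(\mathbf Z)=-\frac1{4\pi}\sum_{1\le i<j\le n}\log|z_i-z_j|^2 .$$ Then this system has infinitely many non-trivial centred relative choreographies (as solutions).
   Context: Notation: $\mathbf Z=(z_1,\dots,z_n)$ with $z_i=(x_i,y_i)\in\mathbb R^2\equiv\mathbb C$, so $\mathbb R^{2n}\equiv\mathbb C^n$. $\Delta=\bigcup_{i<j}\{\mathbf Z: z_i=z_j\}$. $\mathcal J_{\mathbb R^{2n}}$ is the block-diagonal matrix with $n$ blocks $\begin{bmatrix}0&1\\-1&0\end{bmatrix}$. The quantities $I(\mathbf Z)=\sum_i|z_i|^2$ and $\sum_i z_i$ are conserved by this system. Reduction: the system is invariant under rotations and translations. Restricting to $\sum_i z_i=0$ and to a level sphere of $I$ (e.g. $I=1$) and quotienting by the diagonal rotation action gives a reduced Hamiltonian system on (an open subset of) $\mathbb{CP}^{n-2}$. Concretely, fix a unitary map $f\in U(n)$, $W=f(Z)$, with last coordinate $w_n=n^{-1/2}\sum_i z_i$. A centred $\mathbf Z\neq0$ (i.e. $\sum_i z_i=0$) has $f(\mathbf Z)=(w_1,\dots,w_{n-1},0)$ and projects to $[w_1:\dots:w_{n-1}]\in\mathbb{CP}^{n-2}$. Cyclic permutation: $\tilde\sigma(z_1,\dots,z_n)=(z_n,z_1,\dots,z_{n-1})$.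 It induces $\sigma_2:\mathbb{CP}^{n-2}\to\mathbb{CP}^{n-2}$ by $\sigma_2([w_1:\dots:w_{n-1}])=[w_1':\dots:w_{n-1}']$, where $(w_1',\dots,w_{n-1}',0)=f(\tilde\sigma f^{-1}(w_1,\dots,w_{n-1},0))$. A continuous $T$-periodic loop $\mathbf w$ in $\mathbb{CP}^{n-2}$ (normalised to $T=2\pi$ after rescaling time) is a centred reduced choreography if $\mathbf w(t+T/n)=\sigma_2\mathbf w(t)$ for all $t$; it is non-trivial if it is not constant in $\mathbb{CP}^{n-2}$. A curve $\mathbf Z(t)$ is a centred relative choreography if it is a lift of a centred reduced choreography $\mathbf w$ (i.e. $\mathbf Z(t)$ is centred, lies on a level sphere of $I$, and projects to $\mathbf w(t)$ for all $t$); it is non-trivial if $\mathbf w$ is non-trivial.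
   Formalization: The case n = 2 is excluded (n is even with n ≥ 4), because for n = 2 the reduced space CP^0 is a single point, every reduced loop is constant, and no non-trivial centred relative choreography exists. *)

(* Defs.v *)
From HB Require Import structures.
From mathcomp Require Import all_boot all_order all_algebra.
From mathcomp Require Import spectral complex.
From mathcomp Require Import all_classical all_reals all_analysis.

Set Implicit Arguments.
Unset Strict Implicit.
Unset Printing Implicit Defensive.

Import Order.TTheory GRing.Theory Num.Theory.
Import numFieldNormedType.Exports.

Local Open Scope classical_set_scope.
Local Open Scope ring_scope.
Local Open Scope complex_scope.
Local Open Scope quotient_scope.

Section PointVortices.
Context {R : realType} {n : nat}.

(* The phase space R^{2n} is 'M[R]_(n, 2): row i is z_i = (x_i, y_i). *)

Definition cplx (Z : 'M[R]_(n, 2)) : 'cV[R[i]]_n :=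
  \col_i (Z i 0 +i* Z i 1).

Definition sqdist (Z : 'M[R]_(n, 2)) (i j : 'I_n) : R :=
  (Z i 0 - Z j 0) ^+ 2 + (Z i 1 - Z j 1) ^+ 2.

Definition collisions : set 'M[R]_(n, 2) :=
  [set Z | exists i j : 'I_n, (i < j)%N /\ row i Z = row j Z].

Definition hamiltonian (Z : 'M[R]_(n, 2)) : R :=
  - (4 * pi)^-1 * \sum_(i < n) \sum_(j < n | (i < j)%N) ln (sqdist Z i j).

Definition gradient (H : 'M[R]_(n, 2) -> R) (Z : 'M[R]_(n, 2)) :
  'M[R]_(n, 2) := \matrix_(i, k) 'D_(delta_mx i k) H Z.

(* The block [[0, 1], [-1, 0]]; it acts on column vectors, hence the
   transpose when it is applied to all the rows z_i at once. *)
Definition Jblock : 'M[R]_2 :=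
  \matrix_(i, j) (if i == j then 0 else if (i < j)%N then 1 else -1).

Definition Jmx (Z : 'M[R]_(n, 2)) : 'M[R]_(n, 2) := Z *m Jblock^T.

Definition vortex_solution (Z : R -> 'M[R]_(n, 2)) : Prop :=
  forall t : R, ~ collisions (Z t) /\
    is_derive t 1 Z (Jmx (gradient hamiltonian (Z t))).

Definition inertia (Z : 'M[R]_(n, 2)) : R :=
  \sum_(i < n) (Z i 0 ^+ 2 + Z i 1 ^+ 2).

Definition centred (Z : 'M[R]_(n, 2)) : Prop := \sum_(i < n) row i Z = 0.

End PointVortices.

Section ProjectiveSpace.
Context {R : realType} {k : nat}.

(* [R[i]^o] is the alias of [R[i]] that carries the usual topology. *)
Definition nonzero_set : set 'cV[R[i]^o]_k := [set w | w != 0].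

Definition proj_equiv (v w : nonzero_set) : bool :=
  `[< exists2 c : R[i], c != 0 & val v = c *: val w >].

Lemma proj_equivP (v w : nonzero_set) :
  reflect (exists2 c : R[i], c != 0 & val v = c *: val w) (proj_equiv v w).
Proof. exact: asboolP. Qed.

Lemma proj_equiv_refl : reflexive proj_equiv.
Proof. by move=> v; apply/proj_equivP; exists 1; rewrite ?oner_neq0 ?scale1r. Qed.

Lemma proj_equiv_sym : symmetric proj_equiv.
Proof.
suff imp v w : proj_equiv v w -> proj_equiv w v.
  by move=> v w; apply/idP/idP; exact: imp.
move=> /proj_equivP[c c0 vE]; apply/proj_equivP; exists c^-1.
  by rewrite invr_eq0.
by rewrite vE scalerA mulVf // scale1r.
Qed.

Lemma proj_equiv_trans : transitive proj_equiv.
Proof.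
move=> w v u /proj_equivP[c c0 vE] /proj_equivP[d d0 wE].
by apply/proj_equivP; exists (c * d); rewrite ?mulf_neq0 // vE wE scalerA.
Qed.

Canonical proj_equiv_rel :=
  EquivRel proj_equiv proj_equiv_refl proj_equiv_sym proj_equiv_trans.

End ProjectiveSpace.

(* k is the number of homogeneous coordinates: [projspace R k] is CP^(k-1),
   with the quotient topology of C^k minus the origin. *)
Definition projspace (R : realType) (k : nat) :=
  quotient_topology {eq_quot (@proj_equiv_rel R k)}.

HB.instance Definition _ (R : realType) (k : nat) :=
  Topological.on (projspace R k).
HB.instance Definition _ (R : realType) (k : nat) :=
  Quotient.on (projspace R k).

Section Reduction.
Context {R : realType} {n : nat}.
Implicit Types (f : 'M[R[i]]_n) (Z : 'M[R]_(n, 2)).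

(* f is unitary and its last row sends Z to n^{-1/2} \sum_i z_i. *)
Definition reducing_unitary f : Prop :=
  f \is unitarymx /\
  forall i j : 'I_n, i = n.-1 :> nat -> f i j = ((Num.sqrt n%:R)^-1)%:C.

(* (w_1, ..., w_{n-1}) |-> (w_1, ..., w_{n-1}, 0) *)
Definition append0 (w : 'cV[R[i]]_n.-1) : 'cV[R[i]]_n :=
  \col_i oapp (fun j : 'I_n.-1 => w j 0) 0 (insub (i : nat)).

Definition drop_last (w : 'cV[R[i]]_n) : 'cV[R[i]]_n.-1 :=
  \col_i w (widen_ord (leq_pred n) i) 0.

(* (z_1, ..., z_n) |-> (z_n, z_1, ..., z_{n-1}) *)
Definition cyclic_shift (z : 'cV[R[i]]_n) : 'cV[R[i]]_n :=
  \col_i z (ord_pred i) 0.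

Definition sigma2_lift f (w : 'cV[R[i]]_n.-1) : 'cV[R[i]]_n.-1 :=
  drop_last (f *m cyclic_shift (invmx f *m append0 w)).

(* The default value of [insubd] is never used when f is a reducing unitary,
   and the choice of [repr p] is then immaterial; see [sigma2_piE]. *)
Definition sigma2 f (p : projspace R n.-1) : projspace R n.-1 :=
  \pi_(projspace R n.-1) (insubd (repr p) (sigma2_lift f (val (repr p)))).

Definition projects_to f Z (p : projspace R n.-1) : Prop :=
  exists w : @nonzero_set R n.-1,
    f *m cplx Z = append0 (val w) /\ p = \pi_(projspace R n.-1) w.

Definition centred_reduced_choreography f (T : R)
    (w : R -> projspace R n.-1) : Prop :=
  [/\ 0 < T, continuous w, forall t, w (t + T) = w t &
      forall t, w (t + T / n%:R) = sigma2 f (w t)].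

(* For n = 2 there is no such loop: CP^0 is a point. *)
Definition nontrivial_loop (w : R -> projspace R n.-1) : Prop :=
  ~ exists p, forall t, w t = p.

Definition lifts f (Z : R -> 'M[R]_(n, 2)) (w : R -> projspace R n.-1) : Prop :=
  [/\ forall t, centred (Z t), exists c, forall t, inertia (Z t) = c &
      forall t, projects_to f (Z t) (w t)].

Definition nontrivial_centred_relative_choreography f
    (Z : R -> 'M[R]_(n, 2)) : Prop :=
  exists T w, [/\ centred_reduced_choreography f T w, nontrivial_loop w &
                  lifts f Z w].

(* Relative choreographies are counted through this set: it does not change
   when Z is translated in time, rotated, or rescaled to t |-> r Z(t / r^2),
   operations that make infinitely many solutions out of a single one. *)
Definition reduced_trajectory f (Z : R -> 'M[R]_(n, 2)) :
  set (projspace R n.-1) := [set p | exists t, projects_to f (Z t) p].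

End Reduction.

Section Sigma2.
Context {R : realType} {n : nat}.
Implicit Types (f : 'M[R[i]]_n) (w : 'cV[R[i]]_n.-1).

Lemma append0_last w (i : 'I_n) : i = n.-1 :> nat -> append0 w i 0 = 0.
Proof. by move=> iE; rewrite mxE insubF // iE ltnn. Qed.

Lemma append0K : cancel (@append0 R n) drop_last.
Proof.
move=> w; apply/colP => j; rewrite !mxE /=.
by rewrite insubT /= ?ltn_ord // => jn; congr (w _ 0); exact: val_inj.
Qed.

Lemma drop_lastK (w : 'cV[R[i]]_n) :
  (forall i : 'I_n, i = n.-1 :> nat -> w i 0 = 0) ->
  append0 (drop_last w) = w.
Proof.
move=> w0; apply/colP => i; rewrite mxE; case: insubP => [j _ ji|] /=.
  by rewrite mxE; congr (w _ 0); exact: val_inj.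
rewrite -leqNgt => ni; rewrite w0 //; apply/eqP; rewrite eqn_leq ni andbT.
by rewrite -ltnS prednK ?ltn_ord // (leq_ltn_trans _ (ltn_ord i)).
Qed.

Lemma append0Z (c : R[i]) w : append0 (c *: w) = c *: append0 w.
Proof.
by apply/colP => i; rewrite !mxE; case: insubP => *; rewrite /= ?mxE ?mulr0.
Qed.

Lemma sigma2_liftZ f (c : R[i]) w :
  sigma2_lift f (c *: w) = c *: sigma2_lift f w.
Proof.
rewrite /sigma2_lift append0Z -scalemxAr.
set z := invmx f *m _.
have -> : cyclic_shift (c *: z) = c *: cyclic_shift z.
  by apply/colP => i; rewrite !mxE.
by rewrite -scalemxAr; apply/colP => i; rewrite !mxE.
Qed.

Lemma reducing_unitary_last f (z : 'cV[R[i]]_n) (i : 'I_n) :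
  reducing_unitary f -> i = n.-1 :> nat ->
  (f *m z) i 0 = ((Num.sqrt n%:R)^-1)%:C * \sum_j z j 0.
Proof.
move=> [_ fE] iE; rewrite mxE mulr_sumr.
by apply: eq_bigr => j _; rewrite fE.
Qed.

(* f (sigma~ (f^-1 (w_1, ..., w_{n-1}, 0))) has last coordinate 0. *)
Lemma sigma2_liftE f w : reducing_unitary f ->
  append0 (sigma2_lift f w) = f *m cyclic_shift (invmx f *m append0 w).
Proof.
move=> fu; apply: drop_lastK => i iE.
have fU : f \in unitmx by case: fu => /unitarymx_unit.
rewrite (reducing_unitary_last _ fu iE).
under eq_bigr do rewrite mxE.
have /= <- := @reindex_inj _ _ _ _ _ xpredT
  (fun j => (invmx f *m append0 w) j 0) (@ord_pred_inj n).
by rewrite -(reducing_unitary_last _ fu iE) mulKVmx // append0_last.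
Qed.

Lemma sigma2_lift_neq0 f w : reducing_unitary f ->
  w != 0 -> sigma2_lift f w != 0.
Proof.
move=> fu; apply: contra => /eqP w0.
have fU : f \in unitmx by case: fu => /unitarymx_unit.
have append00 : append0 0 = 0 :> 'cV[R[i]]_n.
  by rewrite -(scale0r 0) append0Z scale0r.
have := sigma2_liftE w fu; rewrite w0 append00 => /(congr1 (mulmx (invmx f))).
rewrite mulmx0 mulKmx // => /esym s0.
have z0 : invmx f *m append0 w = 0.
  apply/colP => i; move/colP: s0 => /(_ (ordS i)).
  by rewrite mxE ordSK => ->; rewrite !mxE.
by rewrite -(append0K w) -(mulKVmx fU (append0 w)) z0 mulmx0 -append00 append0K.
Qed.

Lemma sigma2_piE f (v v' : @nonzero_set R n.-1) : reducing_unitary f ->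
  append0 (val v') = f *m cyclic_shift (invmx f *m append0 (val v)) ->
  sigma2 f (\pi_(projspace R n.-1) v) = \pi_(projspace R n.-1) v'.
Proof.
move=> fu v'E; rewrite /sigma2; set p := \pi_(projspace R n.-1) v.
have /proj_equivP[c c0 vE] : proj_equiv (repr p) v.
  have : \pi_(projspace R n.-1) (repr p) = p by rewrite reprK.
  by move=> /eqmodP.
apply/eqmodP/proj_equivP; exists c => //.
have rp0 : val (repr p) != 0 by have := valP (repr p); rewrite inE.
rewrite insubdK; last by rewrite inE /=; exact: sigma2_lift_neq0.
rewrite vE sigma2_liftZ; congr (_ *: _).
by apply: (can_inj append0K); rewrite sigma2_liftE // v'E.
Qed.

End Sigma2.

(* Main.v *)
Require Import Defs.
From mathcomp Require Import all_boot all_order all_algebra.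
From mathcomp Require Import complex spectral ring lra zify.
From mathcomp Require Import all_classical all_reals all_analysis.

Set Implicit Arguments.
Unset Strict Implicit.
Unset Printing Implicit Defensive.

Import Order.TTheory GRing.Theory Num.Theory.
Import numFieldNormedType.Exports.

Local Open Scope classical_set_scope.
Local Open Scope ring_scope.
Local Open Scope complex_scope.

Local Notation Re := complex.Re.
Local Notation Im := complex.Im.

(** The solutions are made of tight pairs. Write n = 2m. Near each vertex of a
regular m-gon two vortices turn fast around each other at distance of order e,
while the m-gon turns slowly. All the vortices carry one profile
U = 1 + e w, where w has period 2 pi and is close to cis (s) = exp (i s):
[[
  z_j (t) = cis (a t) * cis (2 theta_j) * U (b t - theta_j),
  theta_j = 2 pi j / n,    b of order e^-2.
]]
The factor cis (2 theta_j) has period m in j, whereas theta_j grows by half a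
period when j grows by m. Hence the vortices j and j + m form a pair, the
successive pairs lag behind one another, and a delay theta_1 / b amounts, up
to a rotation, to the relabelling of j into j + 1. This works for every m; if
all pairs turned in phase, the relabelling would not be a single cycle for
even m.

For such a motion the n equations of motion are copies of a single equation
on the circle,
[[
  i conj (w') = 2 e (\sum_(0 < k < n) v_k - Om conj U),
  v_k (s) = 1 / (U (s) - cis (2 theta_k) U (s - theta_k)),
]]
in which the partner k = m contributes the dominant term. For e = 0 it is
i conj (w') = 1 / w_odd, where w_odd is the part of w with odd frequencies,
and cis solves it. The linearised operator maps the Fourier coefficients h_p
to p h_p + (h_odd)_(2 - p). On real coefficients, that is for profiles with
conj w (s) = w (-s), it is invertible apart from the mode p = 0: the coupled
odd modes p and 2 - p have determinant - (p - 1)^2, the mode p = 1 is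
multiplied by 2, a nonzero even mode by p. The mode 0 is absorbed by the free
rotation speed Om. So a contraction argument gives a profile for every small
e, with no resonance condition.

The contraction takes an elementary form once the reciprocals are adjoined to
the unknowns: with d = sqrt e the system becomes X = A + B (X, X), with B
bilinear of size O (d) ([prod_atom], [weight_prod_atom]). The unknowns are
trigonometric polynomials, stored as lists of monomials, and a weighted l1
norm of the coefficients makes the iterates, evaluated at any point, converge
geometrically together with the derivative ([approx_lim_cvg],
[limit_system]). Undoing the change of unknowns gives [profile_exists].

The motion is a solution by [vortex_solutionP]. The sum of the z_j is
conserved, and the relabelling multiplies it by a number different from 1, so
it vanishes; the moment of inertia is conserved as well. The ratio
(z_0 - z_m) / (z_0 + z_m) depends only on the projective point. It changes
sign after half a turn of the pair, so the reduced loop is not constant. Its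
size is comparable to e, so the values e_0 / 10^k give disjoint reduced
trajectories ([pair_ratio]). *)

(** * Complex numbers in coordinates *)

Section ComplexCurves.
Context {R : realType}.
Implicit Types (z : R[i]) (x y t : R).

Lemma cRe_add z1 z2 : Re (z1 + z2) = Re z1 + Re z2.
Proof. by case: z1 z2 => [? ?] []. Qed.

Lemma cIm_add z1 z2 : Im (z1 + z2) = Im z1 + Im z2.
Proof. by case: z1 z2 => [? ?] []. Qed.

Lemma cRe_conj z : Re (conjc z) = Re z.
Proof. by case: z. Qed.

Lemma cIm_conj z : Im (conjc z) = - Im z.
Proof. by case: z. Qed.

Lemma cRe_mul z1 z2 : Re (z1 * z2) = Re z1 * Re z2 - Im z1 * Im z2.
Proof. by case: z1 z2 => [? ?] []. Qed.

Lemma cIm_mul z1 z2 : Im (z1 * z2) = Re z1 * Im z2 + Im z1 * Re z2.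
Proof. by case: z1 z2 => [? ?] []. Qed.

Lemma conjc_add z1 z2 : conjc (z1 + z2) = conjc z1 + conjc z2.
Proof. exact: rmorphD. Qed.

Lemma conjc_sub z1 z2 : conjc (z1 - z2) = conjc z1 - conjc z2.
Proof. exact: rmorphB. Qed.

Lemma conjc_opp z : conjc (- z) = - conjc z.
Proof. by case: z. Qed.

Lemma conjc_sum (I : Type) (r : seq I) (F : I -> R[i]) :
  conjc (\sum_(i <- r) F i) = \sum_(i <- r) conjc (F i).
Proof. exact: (rmorph_sum (@conjc _)). Qed.

Lemma conjc_mul z1 z2 : conjc (z1 * z2) = conjc z1 * conjc z2.
Proof. exact: rmorphM. Qed.

Lemma conjc_i : conjc 'i%C = - 'i%C :> R[i].
Proof. by apply/eqP; rewrite eq_complex /= oppr0 !eqxx. Qed.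

(** The l1 norm of the plane: it is equivalent to the modulus, and
real-valued. *)
Definition cnorm z : R := `|Re z| + `|Im z|.

Lemma cnorm_ge0 z : 0 <= cnorm z.
Proof. exact: addr_ge0. Qed.

Lemma cnorm0 : cnorm 0 = 0.
Proof. by rewrite /cnorm /= !normr0 addr0. Qed.

Lemma cnorm_real x : cnorm x%:C = `|x|.
Proof. by rewrite /cnorm /= normr0 addr0. Qed.

Lemma cnorm1 : cnorm 1 = 1.
Proof. by rewrite (cnorm_real 1) normr1. Qed.

Lemma cnormN z : cnorm (- z) = cnorm z.
Proof. by case: z => a b; rewrite /cnorm /= !normrN. Qed.

Lemma cnormD z1 z2 : cnorm (z1 + z2) <= cnorm z1 + cnorm z2.
Proof.
case: z1 z2 => [a b] [c d]; rewrite /cnorm /= addrACA.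
by rewrite lerD // ler_normD.
Qed.

Lemma cnormB z1 z2 : cnorm (z1 - z2) <= cnorm z1 + cnorm z2.
Proof. by rewrite -(cnormN z2) cnormD. Qed.

Lemma cnormM z1 z2 : cnorm (z1 * z2) <= cnorm z1 * cnorm z2.
Proof.
case: z1 z2 => [a b] [c d]; rewrite /cnorm /=.
have := ler_normB (a * c) (b * d); have := ler_normD (a * d) (b * c).
by rewrite !normrM mulrDl !mulrDr => h1 h2; lra.
Qed.

Lemma cnorm_realM x z : cnorm (x%:C * z) = `|x| * cnorm z.
Proof.
by case: z => a b; rewrite /cnorm /= !mul0r subr0 addr0 !normrM mulrDr.
Qed.

Lemma cnorm_double z : cnorm (2 * z) = 2 * cnorm z.
Proof.
have -> : 2 * z = 2%:C * z by rewrite rmorph_nat.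
by rewrite cnorm_realM ger0_norm.
Qed.

Lemma normr_Re_le z : `|Re z| <= cnorm z.
Proof. by rewrite lerDl. Qed.

Lemma normr_Im_le z : `|Im z| <= cnorm z.
Proof. by rewrite lerDr. Qed.

Lemma cnorm_sum (I : Type) (r : seq I) (F : I -> R[i]) :
  cnorm (\sum_(i <- r) F i) <= \sum_(i <- r) cnorm (F i).
Proof.
elim/big_ind2 : _ => [|z1 a z2 b h1 h2|//]; first by rewrite cnorm0.
exact: le_trans (cnormD _ _) (lerD h1 h2).
Qed.

(** * The unit circle *)

Definition cis x : R[i] := cos x +i* sin x.

Lemma cisD x y : cis (x + y) = cis x * cis y.
Proof.
apply/eqP; rewrite eq_complex /= cosD sinD eqxx /=.
by apply/eqP; rewrite addrC (mulrC (cos x)).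
Qed.

Lemma cis0 : cis 0 = 1.
Proof. by rewrite /cis cos0 sin0. Qed.

Lemma conj_cis x : conjc (cis x) = cis (- x).
Proof. by rewrite /cis /= cosN sinN. Qed.

Lemma cisN_mul x : cis (- x) * cis x = 1.
Proof. by rewrite -cisD addNr cis0. Qed.

Lemma cis_neq0 x : cis x != 0.
Proof.
apply/eqP => c0; have := cisN_mul x; rewrite c0 mulr0 => /eqP.
by rewrite eq_sym oner_eq0.
Qed.

Lemma cnorm_cis_le2 x : cnorm (cis x) <= 2.
Proof. by rewrite /cnorm /= (natrD _ 1 1) lerD // ?cos_max ?sin_max. Qed.

(** Since |cos x| and |sin x| are at most 1, they dominate their squares. *)
Lemma cnorm_cis_ge1 x : 1 <= cnorm (cis x).
Proof.
have sq (a : R) : `|a| <= 1 -> a ^+ 2 <= `|a|.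
  by move=> a1; rewrite -(real_normK (num_real a)) expr2 ler_piMr.
by rewrite /cnorm /= -[leLHS](cos2Dsin2 x) lerD // sq ?cos_max ?sin_max.
Qed.

Lemma cis_pi : cis pi = -1.
Proof. by apply/eqP; rewrite eq_complex /= cospi sinpi oppr0 !eqxx. Qed.

Lemma cis_2pi : cis (2 * pi) = 1.
Proof. by rewrite mulr2n mulrDl mul1r cisD cis_pi mulrNN mulr1. Qed.

Lemma cis_int (p : int) : cis (p%:~R * (2 * pi)) = 1.
Proof.
have nat_case (k : nat) : cis (k%:R * (2 * pi)) = 1.
  by elim: k => [|k IH]; rewrite ?mul0r ?cis0 // -natr1 mulrDl mul1r cisD IH
    cis_2pi mulr1.
case: p => k; first exact: nat_case.
by rewrite NegzE rmorphN /= mulNr -conj_cis nat_case conjc1.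
Qed.

(** By the half-angle formula, cos x = 1 - 2 sin (x / 2) ^ 2 with 0 < x / 2 <
pi. *)
Lemma cis_neq1 x : 0 < x < 2 * pi -> cis x != 1.
Proof.
move=> /andP[x0 x2]; rewrite eq_complex /= negb_and; apply/orP; left.
have -> : x = x / 2 *+ 2 by rewrite mulr2n; field.
rewrite cos_mulr2n cos2sin2.
have : 0 < sin (x / 2).
  apply: sin_gt0_pi; rewrite divr_gt0 //= ltr_pdivrMr //.
  by rewrite mulrC.
by move=> s0; apply/eqP => h; nra.
Qed.

(** * Curves in the complex plane *)

Definition ccvg (u : nat -> R[i]) (l : R[i]) :=
  (Re (u k) @[k --> \oo] --> Re l) /\ (Im (u k) @[k --> \oo] --> Im l).

Lemma ccvg_unique u l1 l2 : ccvg u l1 -> ccvg u l2 -> l1 = l2.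
Proof.
move=> [a1 b1] [a2 b2]; apply/eqP; rewrite eq_complex.
by rewrite (norm_cvg_unique a1 a2) (norm_cvg_unique b1 b2) !eqxx.
Qed.

Lemma ccvg_cst z : ccvg (fun=> z) z.
Proof. by split; exact: cvg_cst. Qed.

Lemma ccvgD u v a b : ccvg u a -> ccvg v b -> ccvg (fun k => u k + v k) (a + b).
Proof.
move=> [u1 u2] [v1 v2]; split.
  by rewrite cRe_add; under eq_fun do rewrite cRe_add; exact: cvgD.
by rewrite cIm_add; under eq_fun do rewrite cIm_add; exact: cvgD.
Qed.

Lemma ccvgM u v a b : ccvg u a -> ccvg v b -> ccvg (fun k => u k * v k) (a * b).
Proof.
move=> [u1 u2] [v1 v2]; split.
  by rewrite cRe_mul; under eq_fun do rewrite cRe_mul; apply: cvgB; exact: cvgM.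
by rewrite cIm_mul; under eq_fun do rewrite cIm_mul; apply: cvgD; exact: cvgM.
Qed.

Lemma ccvg_conj u a : ccvg u a -> ccvg (fun k => conjc (u k)) (conjc a).
Proof.
move=> [u1 u2]; split.
  by rewrite cRe_conj; under eq_fun do rewrite cRe_conj.
by rewrite cIm_conj; under eq_fun do rewrite cIm_conj; exact: cvgN.
Qed.

Lemma ccvg_shift u a : ccvg u a -> ccvg (fun k => u k.+1) a.
Proof.
move=> [u1 u2]; split; first by move: u1; rewrite -cvg_shiftS.
by move: u2; rewrite -cvg_shiftS.
Qed.

Lemma ccvg_cnorm_le u a K : ccvg u a -> (forall k, cnorm (u k) <= K) ->
  cnorm a <= K.
Proof.
move=> [u1 u2] uK.
have cv : cnorm (u k) @[k --> \oo] --> cnorm a.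
  by apply: cvgD; exact: cvg_norm.
by apply: (cvgr_to_le cv); exact: nearW.
Qed.

Lemma ccvg_sum (I : Type) (r : seq I) (u : I -> nat -> R[i]) (a : I -> R[i]) :
  (forall i, ccvg (u i) (a i)) ->
  ccvg (fun k => \sum_(i <- r) u i k) (\sum_(i <- r) a i).
Proof.
move=> ua; elim: r => [|i r IH].
  rewrite big_nil; under eq_fun do rewrite big_nil; exact: ccvg_cst.
by rewrite big_cons; under eq_fun do rewrite big_cons; exact: ccvgD.
Qed.

Definition cderiv (f : R -> R[i]) t (d : R[i]) :=
  is_derive t 1 (fun x => Re (f x)) (Re d) /\
  is_derive t 1 (fun x => Im (f x)) (Im d).

Lemma cderiv_ext f g t d : f =1 g -> cderiv f t d -> cderiv g t d.
Proof. by move=> /funext ->. Qed.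

Lemma cderiv_cst z t : cderiv (fun=> z) t 0.
Proof. by split; exact: is_derive_cst. Qed.

Lemma cderivD f g t a b : cderiv f t a -> cderiv g t b ->
  cderiv (fun x => f x + g x) t (a + b).
Proof.
move=> [f1 f2] [g1 g2]; split.
  by rewrite cRe_add; under eq_fun do rewrite cRe_add; exact: is_deriveD.
by rewrite cIm_add; under eq_fun do rewrite cIm_add; exact: is_deriveD.
Qed.

Lemma cderivM f g t a b : cderiv f t a -> cderiv g t b ->
  cderiv (fun x => f x * g x) t (a * g t + f t * b).
Proof.
move=> [f1 f2] [g1 g2]; split.
  under eq_fun do rewrite cRe_mul.
  apply: (is_derive_eq (is_deriveB (is_deriveM f1 g1) (is_deriveM f2 g2))).
  rewrite /GRing.scale /=.
  case: (f t) (g t) a b {f1 f2 g1 g2} => [? ?] [? ?] [? ?] [? ?] /=.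
  by ring.
under eq_fun do rewrite cIm_mul.
apply: (is_derive_eq (is_deriveD (is_deriveM f1 g2) (is_deriveM f2 g1))).
rewrite /GRing.scale /=.
case: (f t) (g t) a b {f1 f2 g1 g2} => [? ?] [? ?] [? ?] [? ?] /=.
by ring.
Qed.

Lemma cderiv_conj f t a : cderiv f t a -> cderiv (fun x => conjc (f x)) t (conjc a).
Proof.
move=> [f1 f2]; split.
  by rewrite cRe_conj; under eq_fun do rewrite cRe_conj.
by rewrite cIm_conj; under eq_fun do rewrite cIm_conj; exact: is_deriveN.
Qed.

Lemma cderiv_sum (I : Type) (r : seq I) (f : I -> R -> R[i]) (a : I -> R[i]) t :
  (forall i, cderiv (f i) t (a i)) ->
  cderiv (fun x => \sum_(i <- r) f i x) t (\sum_(i <- r) a i).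
Proof.
move=> fa; elim: r => [|i r IH].
  rewrite big_nil; under eq_fun do rewrite big_nil; exact: cderiv_cst.
by rewrite big_cons; under eq_fun do rewrite big_cons; exact: cderivD.
Qed.

Lemma is_derive_affine a b t : is_derive t 1 (fun x : R => a * x + b) a.
Proof.
have h := is_deriveD (is_deriveZ a (is_derive_id t 1)) (is_derive_cst b t 1).
by apply: (is_derive_eq h); rewrite /GRing.scale /= mulr1 addr0.
Qed.

Lemma cderiv_affine f a b t d : cderiv f (a * t + b) d ->
  cderiv (fun x => f (a * x + b)) t (a%:C * d).
Proof.
move=> [f1 f2].
have ha := is_derive_affine a b t.
split.
  apply: (is_derive_eq (@is_derive1_comp _ (fun x => Re (f x))
    (fun x => a * x + b) t _ _ f1 ha)).
  by rewrite /GRing.scale /=; case: (d) => x y /=; ring.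
apply: (is_derive_eq (@is_derive1_comp _ (fun x => Im (f x))
    (fun x => a * x + b) t _ _ f2 ha)).
by rewrite /GRing.scale /=; case: (d) => x y /=; ring.
Qed.

Lemma cderiv_cis t : cderiv cis t ('i%C * cis t).
Proof.
by split; apply: is_derive_eq;
  rewrite /= ?mul0r ?mul1r ?add0r ?addr0 ?sub0r.
Qed.

(** A uniform quadratic remainder passes to limits of functions, which is how
differentiability survives the iteration below. *)
Lemma cderiv_quadratic f t d K :
  (forall h, cnorm (f (t + h) - f t - h%:C * d) <= K * h ^+ 2) -> cderiv f t d.
Proof.
have main (g : R -> R) (c : R) :
    (forall h, `|g (t + h) - g t - h * c| <= K * h ^+ 2) -> is_derive t 1 g c.
  move=> gK; have cv : h^-1 *: ((g \o shift t) (h *: (1 : R)) - g t)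
      @[h --> 0^'] --> c.
    apply/cvgrPdist_le => e e0.
    have K0 : 0 <= K.
      by have := gK 1; rewrite expr1n mulr1; exact: le_trans.
    have d0 : 0 < e / (K + 1) by rewrite divr_gt0 // ltr_wpDl.
    near=> h.
    have h0 : h != 0 by near: h; exact: nbhs_dnbhs_neq.
    have hd : `|h| <= e / (K + 1).
      near: h; apply: dnbhs0_le; exact: d0.
    have -> : c - h^-1 *: ((g \o shift t) (h *: (1 : R)) - g t) =
        - (h^-1 * (g (t + h) - g t - h * c)).
      rewrite /= /GRing.scale /= mulr1 (addrC h t); field.
      by [].
    rewrite normrN normrM normfV.
    apply: (@le_trans _ _ (`|h|^-1 * (K * h ^+ 2))).
      by rewrite ler_wpM2l // invr_ge0.
    have -> : `|h|^-1 * (K * h ^+ 2) = K * `|h|.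
      rewrite -(real_normK (num_real h)); field.
      by rewrite normr_eq0.
    apply: (@le_trans _ _ (K * (e / (K + 1)))); first exact: ler_wpM2l.
    rewrite mulrA ler_pdivrMr ?ltr_wpDl //; nra.
  apply: DeriveDef; first by apply/cvg_ex; exists c.
  exact: cvg_lim cv.
move=> fK; split; apply: main => h; apply: le_trans (fK h).
  rewrite (_ : _ - _ = Re (f (t + h) - f t - h%:C * d)) ?normr_Re_le //.
  by case: (f _) (f _) d {fK} => [? ?] [? ?] [? ?] /=; ring.
rewrite (_ : _ - _ = Im (f (t + h) - f t - h%:C * d)) ?normr_Im_le //.
by case: (f _) (f _) d {fK} => [? ?] [? ?] [? ?] /=; ring.
Unshelve. all: by end_near.
Qed.

Lemma cderiv0_cst f : (forall t, cderiv f t 0) -> forall t s, f t = f s.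
Proof.
move=> f0 t s; apply/eqP; rewrite eq_complex.
have -> := @is_derive_0_is_cst _ (fun x => Re (f x)) t s (fun x => (f0 x).1).
have -> := @is_derive_0_is_cst _ (fun x => Im (f x)) t s (fun x => (f0 x).2).
by rewrite !eqxx.
Qed.

End ComplexCurves.

(** * Second-order expansion of the unit circle *)

Section TaylorCis.
Context {R : realType}.
Implicit Types x h : R.

Lemma normr_sin_le x : `|sin x| <= `|x|.
Proof.
have pos (y : R) : 0 < y -> `|sin y| <= y.
  move=> y0; have cv : {within `[0, y], continuous (@sin R)}.
    by apply: continuous_subspaceT; exact: continuous_sin.
  have [c _] := MVT y0 (fun z _ => is_derive_sin z) cv.
  rewrite sin0 !subr0 => ->; rewrite normrM (gtr0_norm y0).
  by rewrite ler_piMl ?cos_max // ltW.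
have [x0|x0|->] := ltgtP x 0; last by rewrite sin0.
  have x0' : 0 < - x by rewrite oppr_gt0.
  by rewrite -(normrN x) -(normrN (sin x)) -sinN (gtr0_norm x0') pos.
by rewrite (gtr0_norm x0) pos.
Qed.

Lemma cosB1_half x : cos x - 1 = - (2 * sin (x / 2) ^+ 2).
Proof.
have xE : x = x / 2 *+ 2 by rewrite mulr2n; field.
by rewrite {1}xE cos_mulr2n cos2sin2; ring.
Qed.

Lemma normr_cosB1_le x : `|cos x - 1| <= x ^+ 2.
Proof.
rewrite cosB1_half normrN normrM normrX ger0_norm //.
have := normr_sin_le (x / 2); rewrite -ler_sqr ?nnegrE ?normr_ge0 //.
rewrite [X in _ <= X -> _]real_normK ?num_real // expr_div_n.
by have := sqr_ge0 x; set a := `|_| ^+ 2; lra.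
Qed.

Lemma normr_sinBid_le x : `|sin x - x| <= x ^+ 2.
Proof.
have pos (y : R) : 0 < y -> `|sin y - y| <= y ^+ 2.
  move=> y0; pose f (z : R) := sin z - z.
  have dv (z : R) : is_derive z (1 : R) f (cos z - 1).
    exact: (is_deriveB (is_derive_sin z) (is_derive_id z 1)).
  have cv : {within `[0, y], continuous f}.
    apply: continuous_subspaceT => z; apply: cvgB; last exact: cvg_id.
    exact: continuous_sin.
  have [c] := MVT y0 (fun z _ => dv z) cv; rewrite /f.
  rewrite sin0 !subr0 in_itv /= => /andP[c0 cy] ->.
  rewrite normrM (gtr0_norm y0) expr2 ler_wpM2r ?(ltW y0) //.
  have [y1|y1] := leP y 2; last first.
    apply: (le_trans _ (ltW y1)); apply: (le_trans (ler_normB _ _)).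
    by rewrite normr1 (natrD _ 1 1) lerD2r cos_max.
  rewrite cosB1_half normrN normrM normrX ger0_norm //.
  have := normr_sin_le (c / 2); rewrite (@gtr0_norm _ (c / 2)) ?divr_gt0 //.
  have := sin_max (c / 2); have := normr_ge0 (sin (c / 2)).
  set a := `|_|; move=> a0 a1 a2.
  have : a ^+ 2 <= a by rewrite expr2 ler_piMr.
  by lra.
have [x0|x0|->] := ltgtP x 0; last by rewrite sin0 subrr normr0 expr0n.
  have := pos (- x); rewrite oppr_gt0 => /(_ x0).
  by rewrite sinN sqrrN -normrN opprB opprK addrC.
exact: pos.
Qed.

(** By the group law the remainder at x is cis x times the remainder at 0, so
the bound is uniform in x. *)
Lemma cis_taylor x h :
  cnorm (cis (x + h) - cis x - h%:C * ('i%C * cis x)) <= 4 * h ^+ 2.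
Proof.
have -> : cis (x + h) - cis x - h%:C * ('i%C * cis x) =
    cis x * (cis h - 1 - h%:C * 'i%C) by rewrite cisD; ring.
apply: le_trans (cnormM _ _) _.
apply: (@le_trans _ _ (2 * (2 * h ^+ 2))); last by rewrite mulrA -natrM.
apply: ler_pM; rewrite ?cnorm_ge0 ?cnorm_cis_le2 //.
rewrite mulr2n mulrDl mul1r /cnorm lerD //=.
  by rewrite mul0r mulr0 !subr0 normr_cosB1_le.
by rewrite mulr1 mul0r subr0 addr0 normr_sinBid_le.
Qed.

End TaylorCis.

(** * Quadratic equations solved in lists *)

Section QuadraticIteration.
Context {R : realType} {T : Type}.
Variables (B : T -> T -> seq T) (A : seq T) (wt : T -> R).

Definition weight (X : seq T) : R := \sum_(t <- X) wt t.

(** A list stands for the sum of its elements, so concatenation is addition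
and [bilin] is the biadditive extension of [B]. *)
Definition bilin (X Y : seq T) : seq T :=
  flatten [seq flatten [seq B a b | b <- Y] | a <- X].

(** The iteration X_(k+1) = A + B (X_k, X_k), started from X_0 = 0. Lists have
no subtraction, so the pair (X_k, X_(k+1) - X_k) is carried along: by
biadditivity the next difference is B (D, X + D) + B (X, D). *)
Fixpoint stage k : seq T * seq T :=
  if k is l.+1 then
    let: (X, D) := stage l in (X ++ D, bilin D (X ++ D) ++ bilin X D)
  else ([::], A).

Definition approx k := (stage k).1.
Definition increment k := (stage k).2.

Lemma approxS k : approx k.+1 = approx k ++ increment k.
Proof. by rewrite /approx /increment /=; case: (stage k). Qed.

Lemma incrementS k : increment k.+1 =
  bilin (increment k) (approx k.+1) ++ bilin (approx k) (increment k).
Proof. by rewrite approxS /approx /increment /=; case: (stage k). Qed.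

Lemma sum_bilin (V : nmodType) (F : T -> V) X Y :
  \sum_(t <- bilin X Y) F t =
  \sum_(a <- X) \sum_(b <- Y) \sum_(t <- B a b) F t.
Proof.
rewrite /bilin big_flatten big_map; apply: eq_bigr => a _.
by rewrite big_flatten big_map.
Qed.

(** The differences telescope: any additive evaluation F sees the iteration of
the quadratic map. *)
Lemma sum_approxS (V : nmodType) (F : T -> V) k :
  \sum_(t <- approx k.+1) F t =
  \sum_(t <- A) F t + \sum_(t <- bilin (approx k) (approx k)) F t.
Proof.
elim: k => [|k IH]; first by rewrite /= big_nil addr0.
rewrite (approxS k.+1) big_cat IH incrementS big_cat /= -addrA !sum_bilin.
have := approxS k; set y := approx k.+1; set x := approx k.
set d := increment k => yE; congr (_ + _).
rewrite [X in _ = \sum_(a <- X) _]yE big_cat /= addrCA addrC; congr (_ + _).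
rewrite -big_split; apply: eq_bigr => a _ /=.
by rewrite yE big_cat.
Qed.

Hypothesis wt_ge0 : forall t, 0 <= wt t.
Variable C : R.
Hypothesis weight_B : forall a b, weight (B a b) <= C * wt a * wt b.
Hypothesis small : 8 * (C * weight A) <= 1.
Hypothesis C_ge0 : 0 <= C.

Lemma weight_ge0 X : 0 <= weight X.
Proof. exact: sumr_ge0. Qed.

Lemma weight_bilin X Y : weight (bilin X Y) <= C * weight X * weight Y.
Proof.
have -> : C * weight X * weight Y = \sum_(a <- X) \sum_(b <- Y) C * wt a * wt b.
  rewrite /weight [C * _]mulr_sumr big_distrl; apply: eq_bigr => a _ /=.
  by rewrite mulr_sumr.
rewrite {1}/weight sum_bilin; apply: ler_sum => a _; apply: ler_sum => b _.
exact: weight_B.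
Qed.

Lemma weight_cat X Y : weight (X ++ Y) = weight X + weight Y.
Proof. by rewrite /weight big_cat. Qed.

(** B is Lipschitz with constant 4 C |A| <= 1 / 2 on the ball of radius 2 |A|,
so the differences are halved at each step. *)
Lemma weight_stage k : weight (increment k) <= weight A * 2^-1 ^+ k /\
  weight (approx k) <= 2 * weight A * (1 - 2^-1 ^+ k).
Proof.
have a0 := weight_ge0 A.
elim: k => [|k [IHd IHx]].
  split; first by rewrite expr0 mulr1.
  by rewrite expr0 subrr mulr0 /approx /weight /= big_nil.
have e0 : 0 <= (2^-1 : R) ^+ k by rewrite exprn_ge0.
have x1 : weight (approx k.+1) <= 2 * weight A * (1 - 2^-1 ^+ k.+1).
  rewrite approxS weight_cat exprS; move: IHd IHx.
  set e := 2^-1 ^+ k; rewrite !mulrBr !mulr1 => h1 h2; lra.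
split => //.
rewrite incrementS weight_cat.
have h1 := weight_bilin (increment k) (approx k.+1).
have h2 := weight_bilin (approx k) (increment k).
have xA l : weight (approx l) <= 2 * weight A * (1 - 2^-1 ^+ l) ->
    weight (approx l) <= 2 * weight A.
  by move=> /le_trans; apply; rewrite ler_piMr ?mulr_ge0 // gerBl exprn_ge0.
have d0 := weight_ge0 (increment k).
have h3 : C * weight (increment k) * weight (approx k.+1) <=
    C * weight (increment k) * (2 * weight A).
  by apply: ler_wpM2l; [exact: mulr_ge0|exact: xA].
have h4 : C * weight (approx k) * weight (increment k) <=
    C * (2 * weight A) * weight (increment k).
  by apply: ler_wpM2r => //; apply: ler_wpM2l => //; exact: xA.
have h5 : C * weight A * weight (increment k) <= 8^-1 * weight (increment k).
  apply: ler_wpM2r => //.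
    by rewrite -[8^-1]mulr1 ler_pdivlMl.
rewrite exprS mulrCA; move: IHd h1 h2 h3 h4 h5.
set e := 2^-1 ^+ k; set d := weight (increment k).
move=> IHd h1 h2 h3 h4 h5.
have -> : 2^-1 * (weight A * e) = (weight A * e) / 2 by rewrite mulrC.
lra.
Qed.

Lemma weight_approx_le k : weight (approx k) <= 2 * weight A.
Proof.
have [_ /le_trans] := weight_stage k; apply.
by rewrite ler_piMr ?mulr_ge0 ?weight_ge0 // gerBl exprn_ge0.
Qed.

Lemma cvg_sum_approx (F : T -> R) K : (forall t, `|F t| <= K * wt t) ->
  cvg ((\sum_(t <- approx k) F t) @[k --> \oo]).
Proof.
move=> FK; pose u k := \sum_(t <- increment k) F t.
have uE : (fun k => \sum_(t <- approx k) F t) = series u.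
  apply/funext => k; elim: k => [|k IH].
    by rewrite big_nil /series /= big_geq.
  by rewrite approxS big_cat IH /series /= big_nat_recr.
rewrite uE; apply: normed_cvg.
pose g := geometric (`|K| * weight A) (2^-1 : R).
have h k : 0 <= `|u k| by [].
apply: (@series_le_cvg _ _ g) => [k|k|k|].
- exact: normr_ge0.
- by rewrite /g /= mulr_ge0 ?mulr_ge0 ?weight_ge0 ?exprn_ge0.
- rewrite /g /= -mulrA; apply: le_trans (ler_norm_sum _ _ _) _.
  apply: (@le_trans _ _ (\sum_(t <- increment k) `|K| * wt t)).
    apply: ler_sum => t _; apply: le_trans (FK t) _.
    by rewrite ler_wpM2r // ler_norm.
  rewrite -mulr_sumr ler_wpM2l //.
  by have [] := weight_stage k.
- apply: is_cvg_geometric_series.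
  by rewrite ger0_norm // invf_lt1 // ltr1n.
Qed.

(** The space of lists is not complete; the limit is taken after
evaluation. *)
Definition approx_lim (F : T -> R[i]) : R[i] :=
  lim ((\sum_(t <- approx k) Re (F t)) @[k --> \oo]) +i*
  lim ((\sum_(t <- approx k) Im (F t)) @[k --> \oo]).

Lemma approx_lim_cvg (F : T -> R[i]) K : (forall t, cnorm (F t) <= K * wt t) ->
  ccvg (fun k => \sum_(t <- approx k) F t) (approx_lim F).
Proof.
move=> FK.
have ReS (X : seq T) : Re (\sum_(t <- X) F t) = \sum_(t <- X) Re (F t).
  by elim: X => [|t X IH]; rewrite ?big_nil // !big_cons cRe_add IH.
have ImS (X : seq T) : Im (\sum_(t <- X) F t) = \sum_(t <- X) Im (F t).
  by elim: X => [|t X IH]; rewrite ?big_nil // !big_cons cIm_add IH.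
split; rewrite /=.
  under eq_fun do rewrite ReS.
  apply: (@cvg_sum_approx _ K) => t; exact: le_trans (normr_Re_le _) (FK t).
under eq_fun do rewrite ImS.
apply: (@cvg_sum_approx _ K) => t; exact: le_trans (normr_Im_le _) (FK t).
Qed.

Lemma cnorm_sum_approx (F : T -> R[i]) K k :
  0 <= K -> (forall t, cnorm (F t) <= K * wt t) ->
  cnorm (\sum_(t <- approx k) F t) <= K * (2 * weight A).
Proof.
move=> K0 FK; apply: le_trans (cnorm_sum _ _) _.
apply: (@le_trans _ _ (K * weight (approx k))).
  by rewrite mulr_sumr ler_sum.
by rewrite ler_wpM2l // weight_approx_le.
Qed.

End QuadraticIteration.

(** * Trigonometric polynomials as lists of atoms *)

Section Atoms.
Context {R : realType} {n : nat}.

Definition theta (k : nat) : R := k%:R * (2 * pi) / n%:R.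

Definition harm (p : int) (s : R) : R[i] := cis (p%:~R * s).

Definition oddz (p : int) : bool := odd `|p|%N.

(** Monomials of the unknowns of the quadratic system. [One] is the constant
1, which turns the linear terms into bilinear ones, and [Rot x] the rotation
speed Om. The atoms [Dev p x], [Rec p x] and [Rel p x] are the monomials x cis
(p s) of three series g, q and w: w is the position inside a pair, g its
deviation in w = cis + d ^ 2 g, and 1 - d q is the reciprocal of 1 + d ^ 2
beta, where beta (s) = cis (- s) g_odd (s). The atom [Inv k p c] is the
monomial c cis (p s) of v_k, the inverse of U (s) - cis (2 theta_k) U (s -
theta_k), for k other than 0 and n / 2. The coefficients of g, q and w are
real: this encodes the symmetry conj f (s) = f (- s), which the linearised
equation requires. *)
Inductive atom :=
  | One
  | Rot of R
  | Dev of int & R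
  | Rec of int & R
  | Rel of int & R
  | Inv of 'I_n & int & R[i].

(** The weight is submultiplicative, so that products of trigonometric
polynomials are controlled, and it bounds p ^ 2, so that two derivatives
are. *)
Definition freq_weight (p : int) : R := (1 + `|p%:~R|) ^+ 2.

Definition atom_weight (a : atom) : R :=
  match a with
  | One => 1
  | Rot x => `|x|
  | Dev p x | Rec p x | Rel p x => freq_weight p * `|x|
  | Inv _ p c => freq_weight p * cnorm c
  end.

(** The solution of p h_p + (h_odd)_(2 - p) = x at the mode p. The odd modes p
and 2 - p are coupled by a block of determinant - (p - 1) ^ 2, and the mode 1
is coupled to itself. The mode 0 has no solution; it goes to the rotation
speed, which enters the equation with the factor 2. *)
Definition solve_mode (p : int) (x : R) : seq atom :=
  if p == 0 then [:: Rot (x / 2)]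
  else if p == 1 then [:: Dev 1 (x / 2)]
  else if oddz p then
    [:: Dev p ((p%:~R - 2) * x / (p%:~R - 1) ^+ 2);
        Dev (2 - p) (x / (p%:~R - 1) ^+ 2)]
  else [:: Dev p (x / p%:~R)].

(** The value of v_k for e = 0. It is the inverse of 0, hence 0, for k = 0 and
k = n / 2, so that the sums over k need not exclude these two indices. *)
Definition cinv (k : 'I_n) : R[i] := (1 - cis (2 * theta k))^-1.

(** The multiplier, at the frequency p, of the difference operator D_k w (s) =
w (s) - cis (2 theta_k) w (s - theta_k). *)
Definition dmult (k : 'I_n) (p : int) : R[i] :=
  1 - cis ((2 - p%:~R) * theta k).

Variable d : R.

(** The quadratic part of the system
[[
  w   = cis + d^2 g
  q   = d beta - d^2 q beta
  v_k = c_k - d^2 c_k v_k D_k w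
  L g + 2 (Om - Om_0) = d cis (-s) q beta - 2 d^2 Om conj w - d^2 (F + conj F (-s))
]]
where F is the sum of the c_k v_k D_k w and L is inverted by [solve_mode]. With
the scaling e = d ^ 2 every product carries a factor d, including the linear
dependence of q on g. *)
Definition prod_atom (a b : atom) : seq atom :=
  match a, b with
  | One, Dev q y =>
      Rel q (d ^+ 2 * y) :: (if oddz q then [:: Rec (q - 1) (d * y)] else [::])
  | Rec p x, Dev q y =>
      if oddz q then
        rcons (solve_mode (2 - p - q) (d * x * y)) (Rec (p + q - 1) (- (d ^+ 2 * x * y)))
      else [::]
  | Rot x, Rel q y => solve_mode q (- (2 * d ^+ 2 * x * y))
  | Inv k p c, Rel q y =>
      let e := cinv k * dmult k q * c * y%:C in
      Inv k (p + q) (- ((d ^+ 2)%:C * e)) ::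
      solve_mode (- (p + q)) (- (2 * d ^+ 2 * Re e))
  | _, _ => [::]
  end.

Definition seed : seq atom :=
  [:: One, Rot (Re (\sum_(k < n) cinv k)), Rel 1 1 &
      [seq Inv k 0 (cinv k) | k <- enum 'I_n]].

(** * Bounds on the quadratic map *)

Lemma freq_weight_ge1 p : 1 <= freq_weight p.
Proof. by rewrite -[leLHS](expr1n _ 2) lerXn2r ?nnegrE ?addr_ge0 // lerDl. Qed.

Lemma freq_weight_ge0 p : 0 <= freq_weight p.
Proof. exact: le_trans (freq_weight_ge1 p). Qed.

Lemma freq_weight0 : freq_weight 0 = 1.
Proof. by rewrite /freq_weight mulr0z normr0 addr0 expr1n. Qed.

Lemma freq_weightN p : freq_weight (- p) = freq_weight p.
Proof. by rewrite /freq_weight rmorphN normrN. Qed.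

Lemma freq_weightD p q : freq_weight (p + q) <= freq_weight p * freq_weight q.
Proof.
rewrite /freq_weight -exprMn lerXn2r ?nnegrE ?mulr_ge0 ?addr_ge0 //.
rewrite rmorphD /=; apply: (@le_trans _ _ (1 + (`|p%:~R| + `|q%:~R|))).
  by rewrite lerD2l ler_normD.
by have := mulr_ge0 (normr_ge0 (p%:~R : R)) (normr_ge0 (q%:~R : R)); lra.
Qed.

Lemma norm_le_freq_weight p : `|p%:~R| <= freq_weight p :> R.
Proof. by rewrite /freq_weight; have := normr_ge0 (p%:~R : R); nra. Qed.

Lemma sqr_le_freq_weight p : (p%:~R) ^+ 2 <= freq_weight p :> R.
Proof.
rewrite /freq_weight -(real_normK (num_real (p%:~R : R))).
by have := normr_ge0 (p%:~R : R); nra.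
Qed.

Lemma atom_weight_ge0 a : 0 <= atom_weight a.
Proof.
case: a => //= [p x|p x|p x|_ p c]; apply: mulr_ge0; rewrite ?freq_weight_ge0 //.
exact: cnorm_ge0.
Qed.

(** The case of a product whose frequency is shifted by a constant. *)
Lemma freq_weight_shift p q (c : int) K :
  freq_weight c <= K -> freq_weight (c + (p + q)) <=
    K * (freq_weight p * freq_weight q).
Proof.
move=> cK; apply: le_trans (freq_weightD _ _) _.
by apply: ler_pM => //; rewrite ?freq_weight_ge0 ?freq_weightD.
Qed.

Lemma oddz_far p : oddz p -> p != 1 -> (p <= -1) || (3 <= p).
Proof. by rewrite /oddz; lia. Qed.

(** Every multiplier of [solve_mode] is at most 1, because an odd p other than
1 is at distance at least 2 from 1. The mode 2 - p costs a factor freq_weight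
2 = 9, whence the constant 10 = 1 + 9. *)
Lemma weight_solve_mode p x :
  weight atom_weight (solve_mode p x) <= 10 * (freq_weight p * `|x|).
Proof.
have f0 := freq_weight_ge1 p; have x0 := normr_ge0 x.
have fx : `|x| <= freq_weight p * `|x| by rewrite ler_peMl.
rewrite /solve_mode; case: eqP => [_|/eqP p0].
  by rewrite /weight big_seq1 /= normrM (@ger0_norm _ 2^-1) //; lra.
case: eqP => [->|/eqP p1].
  rewrite /weight big_seq1 /= normrM (@ger0_norm _ 2^-1) //.
  by have := mulr_ge0 (freq_weight_ge0 1) x0; lra.
case: ifP => [op|_]; last first.
  rewrite /weight big_seq1 /= normrM normfV mulrA.
  have : 1 <= `|p%:~R| :> R by rewrite -intr_norm ler1z; lia.
  move=> hp; have : freq_weight p * `|x| / `|p%:~R| <= freq_weight p * `|x|.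
    by rewrite ler_piMr ?mulr_ge0 ?freq_weight_ge0 // invf_le1 // (lt_le_trans ltr01).
  by have := mulr_ge0 (freq_weight_ge0 p) x0; lra.
have far : (p%:~R <= -1 :> R) \/ (3 <= p%:~R :> R).
  by have /orP[h|h] := oddz_far op p1; [left|right]; rewrite -?(ler_int R) in h.
have s1 : 1 <= (p%:~R - 1) ^+ 2 :> R by nra.
have s2 : `|p%:~R - 2| <= (p%:~R - 1) ^+ 2 :> R.
  by rewrite ler_norml; apply/andP; split; nra.
have s0 : 0 < (p%:~R - 1) ^+ 2 :> R by exact: lt_le_trans s1.
rewrite /weight big_cons big_seq1 /= !normrM normfV (gtr0_norm s0).
have h1 : `|p%:~R - 2| * `|x| / (p%:~R - 1) ^+ 2 <= `|x|.
  by rewrite ler_pdivrMr // mulrC ler_wpM2l.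
have h2 : `|x| / (p%:~R - 1) ^+ 2 <= `|x|.
  by rewrite ler_pdivrMr // ler_peMr.
have h3 : freq_weight (2 - p) <= 9 * freq_weight p.
  apply: le_trans (freq_weightD _ _) _; rewrite freq_weightN ler_wpM2r ?freq_weight_ge0 //.
  by rewrite /freq_weight ger0_norm //; lra.
have y0 : 0 <= `|x| / (p%:~R - 1) ^+ 2 by rewrite divr_ge0 // ltW.
have h4 := ler_pM (freq_weight_ge0 (2 - p)) y0 h3 h2.
have h5 := ler_wpM2l (freq_weight_ge0 p) h1.
lra.
Qed.

Definition cinv_bound : R := \sum_(k < n) cnorm (cinv k).

Lemma cnorm_cinv_le (k : 'I_n) : cnorm (cinv k) <= cinv_bound.
Proof.
rewrite /cinv_bound (bigD1 k) //= lerDl.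
by apply: sumr_ge0 => i _; exact: cnorm_ge0.
Qed.

Lemma cnorm_dmult_le k p : cnorm (dmult k p) <= 3.
Proof.
apply: le_trans (cnormB _ _) _.
by rewrite cnorm_real normr1 (natrD _ 1 2) lerD // cnorm_cis_le2.
Qed.

Hypothesis d_ge0 : 0 <= d.
Hypothesis d_le1 : d <= 1.

Let d2_le : d ^+ 2 <= d.
Proof. by rewrite expr2 ler_piMr. Qed.

Let d2_ge0 : 0 <= d ^+ 2.
Proof. exact: exprn_ge0. Qed.

Let norm_pos3 (a x y : R) : 0 <= a -> `|a * x * y| = a * `|x| * `|y|.
Proof. by move=> a0; rewrite 2!normrM ger0_norm. Qed.

Lemma cinv_bound_ge0 : 0 <= cinv_bound.
Proof. by apply: sumr_ge0 => i _; exact: cnorm_ge0. Qed.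

(** 94 = 10 * 9 + 4 comes from the product of [Rec] and [Dev], whose
frequencies are shifted by 2 and by 1, and 63 = 3 + 2 * 10 * 3 from the
product of [Inv] and [Rel], where 3 bounds the multiplier of D_k. *)
Definition prod_bound : R := 94 + 63 * cinv_bound.

Lemma weight_prod_atom a b : weight atom_weight (prod_atom a b) <=
  d * prod_bound * atom_weight a * atom_weight b.
Proof.
have cb0 := cinv_bound_ge0.
have P0 : 0 <= prod_bound by rewrite /prod_bound; lra.
have rhs0 : 0 <= d * prod_bound * atom_weight a * atom_weight b.
  by rewrite !mulr_ge0 ?atom_weight_ge0.
have nilP : weight atom_weight [::] <= d * prod_bound * atom_weight a * atom_weight b.
  by rewrite /weight big_nil.
case: a b rhs0 nilP => [|x|p x|p x|p x|k p c] [|y|q y|q y|q y|l q y] rhs0 nilP //=.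
- set T := freq_weight q * `|y|.
  have T0 : 0 <= T by rewrite mulr_ge0 ?freq_weight_ge0.
  have h1 : freq_weight q * `|d ^+ 2 * y| <= d * T.
    rewrite normrM (ger0_norm d2_ge0) mulrCA.
    by apply: ler_wpM2r.
  have h2 : freq_weight (q - 1) * `|d * y| <= 4 * (d * T).
    rewrite normrM (ger0_norm d_ge0).
    have -> : 4 * (d * T) = 4 * freq_weight q * (d * `|y|) by rewrite /T; ring.
    apply: ler_wpM2r; first by rewrite mulr_ge0.
    have := @freq_weight_shift q 0 (-1) 4; rewrite addr0 (addrC (-1)).
    rewrite freq_weight0 mulr1; apply.
    by rewrite /freq_weight rmorphN normrN normr1; lra.
  have dT : 0 <= d * T by exact: mulr_ge0.
  have h3 : 94 * (d * T) <= d * prod_bound * 1 * T.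
    have -> : d * prod_bound * 1 * T = prod_bound * (d * T) by ring.
    by apply: ler_wpM2r => //; rewrite /prod_bound; lra.
  case: ifP => _; rewrite /weight !big_cons big_nil /= addr0; first by lra.
  by apply: le_trans h1 _; lra.
- set T := freq_weight q * `|y| * `|x|.
  have T0 : 0 <= T by rewrite !mulr_ge0 ?freq_weight_ge0.
  apply: le_trans (weight_solve_mode _ _) _.
  rewrite normrN norm_pos3 ?mulr_ge0 //.
  have -> : 10 * (freq_weight q * (2 * d ^+ 2 * `|x| * `|y|)) = d ^+ 2 * (20 * T).
    by rewrite /T; ring.
  have -> : d * prod_bound * `|x| * (freq_weight q * `|y|) = d * (prod_bound * T).
    by rewrite /T; ring.
  apply: ler_pM => //; first by rewrite mulr_ge0.
  by apply: ler_wpM2r => //; rewrite /prod_bound; lra.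
- case: ifP => _ //.
  set T := freq_weight p * freq_weight q * (`|x| * `|y|).
  have T0 : 0 <= T by rewrite !mulr_ge0 ?freq_weight_ge0.
  have dT : 0 <= d * T by exact: mulr_ge0.
  rewrite /weight -cats1 big_cat big_seq1 /= -/(weight _ _).
  have h1 : weight atom_weight (solve_mode (2 - p - q) (d * x * y)) <= 90 * (d * T).
    apply: le_trans (weight_solve_mode _ _) _; rewrite norm_pos3 //.
    have -> : 90 * (d * T) = 10 * (9 * (freq_weight p * freq_weight q) *
      (d * `|x| * `|y|)) by rewrite /T; ring.
    apply: ler_wpM2l => //; apply: ler_wpM2r; first by rewrite !mulr_ge0.
    have := @freq_weight_shift (- p) (- q) 2 9; rewrite !freq_weightN addrA; apply.
    by rewrite /freq_weight ger0_norm //; lra.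
  have h2 : freq_weight (p + q - 1) * `|- (d ^+ 2 * x * y)| <= 4 * (d * T).
    rewrite normrN norm_pos3 //.
    have -> : 4 * (d * T) = 4 * (freq_weight p * freq_weight q) *
      (d * `|x| * `|y|) by rewrite /T; ring.
    apply: ler_pM; rewrite ?freq_weight_ge0 ?mulr_ge0 //.
      have := @freq_weight_shift p q (-1) 4; rewrite addrC; apply.
      by rewrite /freq_weight rmorphN normrN normr1; lra.
    by rewrite !ler_wpM2r.
  have -> : d * prod_bound * (freq_weight p * `|x|) * (freq_weight q * `|y|) =
    prod_bound * (d * T) by rewrite /T; ring.
  have h3 : 94 * (d * T) <= prod_bound * (d * T).
    by apply: ler_wpM2r => //; rewrite /prod_bound; lra.
  by lra.
- set T := freq_weight p * freq_weight q * (cnorm c * `|y|).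
  have T0 : 0 <= T by rewrite !mulr_ge0 ?freq_weight_ge0 ?cnorm_ge0.
  set e := cinv k * dmult k q * c * y%:C.
  have he : cnorm e <= 3 * cinv_bound * (cnorm c * `|y|).
    apply: le_trans (cnormM _ _) _; rewrite cnorm_real mulrA.
    apply: ler_wpM2r => //; apply: le_trans (cnormM _ _) _.
    apply: ler_wpM2r; first exact: cnorm_ge0.
    apply: le_trans (cnormM _ _) _; rewrite (mulrC 3).
    by apply: ler_pM; rewrite ?cnorm_ge0 ?cnorm_cinv_le ?cnorm_dmult_le.
  rewrite /weight big_cons /= -/(weight _ _).
  have fpq : freq_weight (p + q) * cnorm e <= 3 * cinv_bound * T.
    have -> : 3 * cinv_bound * T = freq_weight p * freq_weight q *
      (3 * cinv_bound * (cnorm c * `|y|)) by rewrite /T; ring.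
    by apply: ler_pM; rewrite ?freq_weight_ge0 ?cnorm_ge0 ?freq_weightD.
  have cbT : 0 <= cinv_bound * T by exact: mulr_ge0.
  have h1 : freq_weight (p + q) * cnorm (- ((d ^+ 2)%:C * e)) <= d * (3 * cinv_bound * T).
    rewrite cnormN; apply: (@le_trans _ _ (d ^+ 2 * (freq_weight (p + q) * cnorm e))).
      rewrite [leRHS]mulrCA; apply: ler_wpM2l; first exact: freq_weight_ge0.
      by apply: le_trans (cnormM _ _) _; rewrite cnorm_real ger0_norm.
    by apply: ler_pM => //; rewrite mulr_ge0 ?freq_weight_ge0 ?cnorm_ge0.
  have h2 : weight atom_weight (solve_mode (- (p + q)) (- (2 * d ^+ 2 * Re e))) <=
      d * (60 * cinv_bound * T).
    apply: le_trans (weight_solve_mode _ _) _.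
    rewrite freq_weightN normrN normrM (@ger0_norm _ (2 * d ^+ 2)) ?mulr_ge0 //.
    have -> : 10 * (freq_weight (p + q) * (2 * d ^+ 2 * `|Re e|)) =
      d ^+ 2 * (20 * (freq_weight (p + q) * `|Re e|)) by ring.
    apply: ler_pM => //; first by rewrite !mulr_ge0 ?freq_weight_ge0.
    have : freq_weight (p + q) * `|Re e| <= freq_weight (p + q) * cnorm e.
      by apply: ler_wpM2l; [exact: freq_weight_ge0|exact: normr_Re_le].
    by lra.
  have -> : d * prod_bound * (freq_weight p * cnorm c) * (freq_weight q * `|y|) =
    d * (94 * T) + d * (63 * cinv_bound * T) by rewrite /T /prod_bound; ring.
  have : 0 <= d * (94 * T) by apply: mulr_ge0 => //; exact: mulr_ge0.
  by lra.
Qed.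

(** * Evaluation of atoms *)

Definition eOne a : R[i] := if a is One then 1 else 0.
Definition eRot a : R[i] := if a is Rot x then x%:C else 0.
Definition eDev s a : R[i] := if a is Dev p x then x%:C * harm p s else 0.
Definition eDev' s a : R[i] :=
  if a is Dev p x then (p%:~R * x)%:C * 'i%C * harm p s else 0.
Definition eBeta s a : R[i] :=
  if a is Dev p x then (if oddz p then x%:C * harm (p - 1) s else 0) else 0.
Definition eRec s a : R[i] := if a is Rec p x then x%:C * harm p s else 0.
Definition eRel s a : R[i] := if a is Rel p x then x%:C * harm p s else 0.
Definition eInv (k : 'I_n) s a : R[i] :=
  if a is Inv l p c then (if l == k then c * harm p s else 0) else 0.

(** The linear operator i conj (g') + cis (- s) beta, together with the
rotation speed that takes care of the mode 0. *)
Definition eLin s a : R[i] :=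
  'i%C * conjc (eDev' s a) + cis (- s) * eBeta s a + 2%:C * eRot a.

Definition eDiff (k : 'I_n) s a : R[i] :=
  eRel s a - cis (2 * theta k) * eRel (s - theta k) a.

Lemma eLin_Rot s x : eLin s (Rot x) = 2%:C * x%:C.
Proof. by rewrite /eLin /eDev' /eBeta conjc0 !mulr0 !add0r. Qed.

Lemma eLin0 s a : (if a is Dev _ _ then False else True) ->
  (if a is Rot _ then False else True) -> eLin s a = 0.
Proof.
by case: a => //= *; rewrite /eLin /eDev' /eBeta /eRot conjc0 !mulr0 !addr0.
Qed.

Lemma harmD p q s : harm (p + q) s = harm p s * harm q s.
Proof. by rewrite /harm rmorphD mulrDl cisD. Qed.

Lemma harm0 s : harm 0 s = 1.
Proof. by rewrite /harm mul0r cis0. Qed.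

Lemma harm1 s : harm 1 s = cis s.
Proof. by rewrite /harm mul1r. Qed.

Lemma harmN p s : harm (- p) s = harm p (- s).
Proof. by rewrite /harm rmorphN mulNr mulrN. Qed.

Lemma conj_harm p s : conjc (harm p s) = harm p (- s).
Proof. by rewrite /harm conj_cis mulrN. Qed.

Lemma harmB p s t : harm p (s - t) = harm p s * cis (- (p%:~R * t)).
Proof. by rewrite /harm mulrBr cisD. Qed.

(** This is the sense in which [solve_mode] inverts the linear operator: the
result is x cis (- p s) for every p, the mode 0 included. *)
Lemma sum_solve_mode_eLin p x s :
  \sum_(t <- solve_mode p x) eLin s t = x%:C * harm p (- s).
Proof.
have h1 : cis (- s) = harm 1 (- s) by rewrite harm1.
have ii : 'i%C * - 'i%C = 1 :> R[i] by rewrite mulrN -expr2 sqr_i opprK.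
have term q y : 'i%C * conjc ((q%:~R * y)%:C * 'i%C * harm q s) =
    (q%:~R * y)%:C * harm q (- s).
  by rewrite !conjc_mul conjc_i conj_harm conjc_real mulrA mulrCA ii mulr1.
rewrite /solve_mode; case: eqP => [->|/eqP p0].
  rewrite big_seq1 eLin_Rot harm0 mulr1 -rmorphM /=.
  by congr (_%:C); field.
case: eqP => [->|/eqP p1].
  rewrite big_seq1 /eLin /eDev' /eBeta /eRot term /= mulr0 addr0 subrr harm0 harm1 mulr1.
  rewrite mul1r mulrC -mulrDr -!rmorphD /= mulrC.
  by congr (_%:C * _); field.
case: ifP => [op|ne].
  rewrite big_cons big_seq1 /eLin /eDev' /eBeta /eRot !term.
  have -> : oddz (2 - p) by move: op; rewrite /oddz; lia.
  rewrite op !mulr0 !addr0.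
  have e1 : cis (- s) * harm (p - 1) s = harm (2 - p) (- s).
    by rewrite h1 -!harmN -harmD; congr harm; ring.
  have e2 : cis (- s) * harm (2 - p - 1) s = harm p (- s).
    by rewrite h1 -!harmN -harmD; congr harm; ring.
  rewrite !(mulrCA (cis (- s))) e1 e2.
  have q1 : (p%:~R - 1 : R) != 0 by rewrite subr_eq0 -[1]/(1%:~R) eqr_int.
  set u := harm p (- s); set v := harm (2 - p) (- s).
  set a := _%:C; set b := (_ / _)%:C; set c := (_ * _)%:C; set f := (_ / _)%:C.
  have -> : a * u + b * v + (c * v + f * u) = (a + f) * u + (b + c) * v by ring.
  have -> : a + f = x%:C.
    rewrite /a /f -rmorphD /=; congr (_%:C); field; exact: q1.
  have -> : b + c = 0.
    rewrite /b /c -rmorphD /= rmorphB /=.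
    have -> : (0 : R[i]) = 0%:C by [].
    congr (_%:C); field; exact: q1.
  by rewrite mul0r addr0.
rewrite big_seq1 /eLin /eDev' /eBeta /eRot term ne !mulr0 !addr0.
congr (_%:C * _); field.
by rewrite intr_eq0.
Qed.

Lemma sum_solve_mode0 (F : atom -> R[i]) p x :
  (forall y, F (Rot y) = 0) -> (forall q y, F (Dev q y) = 0) ->
  \sum_(t <- solve_mode p x) F t = 0.
Proof.
move=> F1 F2; rewrite /solve_mode; do !case: ifP => _;
  by rewrite !big_cons big_nil ?F1 ?F2 !addr0.
Qed.

Lemma sum_prod_eOne a b : \sum_(t <- prod_atom a b) eOne t = 0.
Proof.
case: a b => [|x|p x|p x|p x|k p c] [|y|q y|q y|q y|l q y] //=; rewrite ?big_nil //.
- by case: ifP => _; rewrite !big_cons big_nil /= !addr0.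
- by rewrite sum_solve_mode0.
- by case: ifP => _; rewrite ?big_nil // -cats1 big_cat big_seq1 /= sum_solve_mode0 // addr0.
- by rewrite big_cons sum_solve_mode0 // addr0.
Qed.

Lemma sum_prod_eRel s a b :
  \sum_(t <- prod_atom a b) eRel s t = (d ^+ 2)%:C * (eOne a * eDev s b).
Proof.
case: a b => [|x|p x|p x|p x|k p c] [|y|q y|q y|q y|l q y] //=;
  rewrite ?big_nil ?mul0r ?mulr0 //.
- by case: ifP => _; rewrite !big_cons big_nil /= !addr0 mul1r rmorphM /= mulrA.
- by rewrite sum_solve_mode0.
- by case: ifP => _; rewrite ?big_nil // -cats1 big_cat big_seq1 /= sum_solve_mode0 // addr0.
- by rewrite big_cons sum_solve_mode0 // addr0.
Qed.

Lemma sum_prod_eRec s a b :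
  \sum_(t <- prod_atom a b) eRec s t =
  d%:C * (eOne a * eBeta s b) - (d ^+ 2)%:C * (eRec s a * eBeta s b).
Proof.
case: a b => [|x|p x|p x|p x|k p c] [|y|q y|q y|q y|l q y] //=;
  rewrite ?big_nil ?mul0r ?mulr0 ?subr0 //.
- case: ifP => _; rewrite !big_cons big_nil /= ?mulr0 !addr0 // add0r.
  by rewrite mul1r rmorphM /= mulrA.
- by rewrite sum_solve_mode0.
- case: ifP => _; rewrite ?big_nil ?mulr0 ?subr0 // -cats1 big_cat big_seq1 /=.
  rewrite sum_solve_mode0 // add0r -addrA !harmD rmorphN !rmorphM /= sub0r.
  by ring.
- by rewrite big_cons sum_solve_mode0 // addr0.
Qed.

Lemma eDiffE k s q y : eDiff k s (Rel q y) = y%:C * dmult k q * harm q s.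
Proof.
rewrite /eDiff /= harmB /dmult.
have -> : (2 - q%:~R) * theta k = 2 * theta k + - (q%:~R * theta k) by ring.
by rewrite cisD; ring.
Qed.

Lemma sum_prod_eInv k s a b :
  \sum_(t <- prod_atom a b) eInv k s t =
  - ((d ^+ 2)%:C * (cinv k * (eInv k s a * eDiff k s b))).
Proof.
case: a b => [|x|p x|p x|p x|l p c] [|y|q y|q y|q y|j q y];
  rewrite ?eDiffE //= /eDiff /= ?big_nil ?mulr0 ?subr0 ?mul0r ?mulr0 ?oppr0 //.
- by case: ifP => _; rewrite !big_cons big_nil /= !addr0.
- by rewrite sum_solve_mode0.
- by case: ifP => _; rewrite ?big_nil // -cats1 big_cat big_seq1 /= sum_solve_mode0 // addr0.
- rewrite big_cons sum_solve_mode0 // addr0 /=; case: eqP => [<-|_]; last first.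
    by rewrite mul0r !mulr0 oppr0.
  by rewrite harmD; ring.
Qed.

Definition forcing s a b : R[i] :=
  \sum_(k < n) cinv k * (eInv k s a * eDiff k s b).

(** The real part in [prod_atom] keeps the coefficients real; on functions it
is the symmetrisation of F (s) into F (s) + conj (F (- s)). *)
Lemma sum_prod_eLin s a b :
  \sum_(t <- prod_atom a b) eLin s t =
  d%:C * (cis (- s) * (eRec s a * eBeta s b))
  - (2 * d ^+ 2)%:C * (eRot a * eRel (- s) b)
  - (d ^+ 2)%:C * (forcing s a b + conjc (forcing (- s) a b)).
Proof.
have F0 s' : (forall k, eInv k s' a = 0) \/ (forall k, eDiff k s' b = 0) ->
    forcing s' a b = 0.
  by case=> h; apply: big1 => k _; rewrite h ?mul0r !mulr0.
have ng : (forall s' k, eInv k s' a = 0) \/ (forall s' k, eDiff k s' b = 0) ->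
    forcing s a b + conjc (forcing (- s) a b) = 0.
  by case=> h; rewrite !F0 ?conjc0 ?addr0 //; [left|left|right|right].
have D0 y : (forall s', eRel s' y = 0) -> forall s' k, eDiff k s' y = 0.
  by move=> h s' k; rewrite /eDiff !h mulr0 subr0.
case: a b ng {F0} => [|x|p x|p x|p x|l p c] [|y|q y|q y|q y|j q y] ng;
 try (rewrite ng; last by [left|right; apply: D0]);
 rewrite /= ?big_nil ?mulr0 ?subr0 ?mul0r ?mulr0 ?subr0 //.
- by case: ifP => _; rewrite !big_cons big_nil !eLin0 // !addr0.
- rewrite sum_solve_mode_eLin sub0r rmorphN !rmorphM /=; ring.
- case: ifP => _; rewrite ?big_nil ?mulr0 // -cats1 big_cat big_seq1 /= sum_solve_mode_eLin.
  rewrite eLin0 // addr0 -harmN.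
  have -> : - (2 - p - q) = - 1 + (p + (q - 1)) by ring.
  by rewrite !harmD harmN harm1 !rmorphM /=; ring.
- rewrite big_cons sum_solve_mode_eLin eLin0 // add0r.
  have fE s' : forcing s' (Inv l p c) (Rel q y) =
      cinv l * dmult l q * c * y%:C * harm (p + q) s'.
    rewrite /forcing (bigD1 l) //= eqxx big1 ?addr0; last first.
      by move=> k kl; rewrite eq_sym (negPf kl) mul0r mulr0.
    by rewrite eDiffE harmD; ring.
  rewrite !fE conjc_mul conj_harm harmN opprK.
  set e := _ * y%:C; rewrite -mulrDl.
  have -> : e + conjc e = (2 * Re e)%:C by rewrite addcJ rmorphM rmorph_nat.
  by rewrite rmorphN !rmorphM /= sub0r; ring.
Qed.

End Atoms.

Arguments theta {R} n k.

(** * Passage to the limit *)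

Section Limit.
Context {R : realType} {n : nat}.
Local Notation atom := (@atom R n).
Local Notation weightA := (weight (@atom_weight R n)).
Implicit Types (a b t : atom).

Lemma cnorm_harm_le p (s : R) : cnorm (harm p s) <= 2.
Proof. exact: cnorm_cis_le2. Qed.

Lemma cnorm_scaled_harm p (s x : R) c : cnorm (x%:C * harm c s) <=
  2 * (freq_weight p * `|x|).
Proof.
apply: le_trans (cnormM _ _) _; rewrite cnorm_real mulrC.
apply: ler_pM; rewrite ?cnorm_ge0 ?cnorm_harm_le //.
by rewrite ler_peMl // freq_weight_ge1.
Qed.

Definition weight_bounded (F : atom -> R[i]) :=
  forall t, cnorm (F t) <= 2 * atom_weight t.

Let zero_ok t : cnorm (0 : R[i]) <= 2 * atom_weight t.
Proof. by rewrite cnorm0 mulr_ge0 ?atom_weight_ge0. Qed.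

Lemma weight_bounded_One : weight_bounded (@eOne R n).
Proof.
move=> t; case: t (zero_ok t) => //= _.
by rewrite (cnorm_real 1) normr1 mulr1 ler1n.
Qed.

Lemma weight_bounded_Rot : weight_bounded (@eRot R n).
Proof.
move=> t; case: t (zero_ok t) => //= x _.
by rewrite cnorm_real ler_peMl // ler1n.
Qed.

Lemma weight_bounded_Dev s : weight_bounded (eDev s).
Proof. by move=> t; case: t (zero_ok t) => //= *; exact: cnorm_scaled_harm. Qed.

Lemma weight_bounded_Rec s : weight_bounded (eRec s).
Proof. by move=> t; case: t (zero_ok t) => //= *; exact: cnorm_scaled_harm. Qed.

Lemma weight_bounded_Rel s : weight_bounded (eRel s).
Proof. by move=> t; case: t (zero_ok t) => //= *; exact: cnorm_scaled_harm. Qed.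

Lemma weight_bounded_Beta s : weight_bounded (eBeta s).
Proof.
move=> t; case: t (zero_ok t) => //= p x h.
by case: ifP => _ //; exact: cnorm_scaled_harm.
Qed.

Lemma weight_bounded_Inv k s : weight_bounded (eInv k s).
Proof.
move=> t; case: t (zero_ok t) => //= l p c h.
case: ifP => _ //; apply: le_trans (cnormM _ _) _; rewrite mulrC.
apply: ler_pM; rewrite ?cnorm_ge0 ?cnorm_harm_le //.
by rewrite ler_peMl ?cnorm_ge0 // freq_weight_ge1.
Qed.

Lemma weight_bounded_Dev' s : weight_bounded (eDev' s).
Proof.
move=> t; case: t (zero_ok t) => //= p x _.
apply: le_trans (cnormM _ _) _; rewrite mulrC.
apply: ler_pM; rewrite ?cnorm_ge0 ?cnorm_harm_le //.
apply: le_trans (cnormM _ _) _; rewrite cnorm_real normrM.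
rewrite [cnorm _](_ : _ = 1) ?mulr1; last by rewrite /cnorm /= normr0 normr1 add0r.
by rewrite ler_wpM2r // norm_le_freq_weight.
Qed.

Lemma taylor_Dev s h t :
  cnorm (eDev (s + h) t - eDev s t - h%:C * eDev' s t) <=
  4 * h ^+ 2 * atom_weight t.
Proof.
have z0 : cnorm (0 : R[i]) <= 4 * h ^+ 2 * atom_weight t.
  by rewrite cnorm0 mulr_ge0 ?atom_weight_ge0 // mulr_ge0 ?sqr_ge0.
case: t z0 => [|x|p x|p x|p x|k p c] z0; rewrite /eDev /eDev' /= ?mulr0 ?subrr ?subr0 //.
have -> : x%:C * harm p (s + h) - x%:C * harm p s -
    h%:C * ((p%:~R * x)%:C * 'i%C * harm p s) =
    x%:C * (cis (p%:~R * s + p%:~R * h) - cis (p%:~R * s) -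
      (p%:~R * h)%:C * ('i%C * cis (p%:~R * s))).
  by rewrite /harm mulrDr !rmorphM /=; ring.
apply: le_trans (cnormM _ _) _; rewrite cnorm_real.
have h1 := cis_taylor (p%:~R * s) (p%:~R * h).
apply: le_trans (ler_wpM2l (normr_ge0 _) h1) _.
have -> : `|x| * (4 * (p%:~R * h) ^+ 2) = p%:~R ^+ 2 * (4 * h ^+ 2 * `|x|) by ring.
have -> : 4 * h ^+ 2 * (freq_weight p * `|x|) =
  freq_weight p * (4 * h ^+ 2 * `|x|) by ring.
by rewrite ler_wpM2r ?sqr_le_freq_weight // mulr_ge0 // mulr_ge0 ?sqr_ge0.
Qed.

Lemma conj_eRel s t : conjc (eRel s t) = eRel (- s) t.
Proof.
case: t => [|x|p x|p x|p x|k p c]; rewrite /eRel ?conjc0 //.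
by rewrite conjc_mul conj_harm conjc_real.
Qed.

Lemma conj_eRot t : conjc (eRot t) = eRot t.
Proof. by case: t => [|x|p x|p x|p x|k p c]; rewrite /eRot ?conjc0 ?conjc_real. Qed.

Lemma harm_period p (s : R) : harm p (s + 2 * pi) = harm p s.
Proof. by rewrite /harm mulrDr cisD cis_int mulr1. Qed.

Lemma eDev_period s t : eDev (s + 2 * pi) t = eDev s t.
Proof. by case: t => //= p x; rewrite harm_period. Qed.

Lemma cis_int_pi (p : int) : cis (- (p%:~R * pi)) = (if oddz p then -1 else 1) :> R[i].
Proof.
rewrite -mulNr -mulrNz; have -> : oddz p = oddz (- p) by rewrite /oddz; lia.
move: (- p) => {}p.
have [q ->] : exists q : int, p = 2 * q + (oddz p)%:Z.
  by exists (p %/ 2)%Z; rewrite /oddz; lia.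
rewrite (_ : oddz _ = oddz p); last by rewrite /oddz; lia.
rewrite rmorphD rmorphM /= mulrDl (mulrC 2%:~R) -mulrA cisD cis_int mul1r.
by case: oddz; rewrite ?mul1r ?cis_pi // mul0r cis0.
Qed.

(** Translation by pi changes the sign of the odd frequencies and fixes the
even ones. *)
Lemma eBetaE s t : eBeta s t = cis (- s) * ((eDev s t - eDev (s - pi) t) / 2).
Proof.
case: t => [|x|p x|p x|p x|k p c]; rewrite /eBeta /eDev ?subrr ?mul0r ?mulr0 //.
rewrite harmB cis_int_pi; case: ifP => _; last by rewrite mulr1 subrr mul0r mulr0.
rewrite harmD harmN harm1 mulrN1 mulrN opprK.
by field.
Qed.

Variable d : R.
Hypothesis d_ge0 : 0 <= d.
Hypothesis d_le1 : d <= 1.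
Local Notation seedA := (@seed R n).
Hypothesis d_small : 8 * (d * prod_bound (n := n) * weightA seedA) <= 1.

Local Notation S F k := (\sum_(t <- approx (prod_atom d) seedA k) F t).
Local Notation L F := (approx_lim (prod_atom d) seedA F).

Let P_ge0 : 0 <= d * prod_bound (R := R) (n := n).
Proof.
by rewrite mulr_ge0 // addr_ge0 // mulr_ge0 // cinv_bound_ge0.
Qed.

Let limP F : weight_bounded F -> ccvg (fun k => S F k) (L F).
Proof.
exact: (approx_lim_cvg (@atom_weight_ge0 R n)
  (weight_prod_atom d_ge0 d_le1) d_small P_ge0).
Qed.

Let limB F : weight_bounded F -> cnorm (L F) <= 4 * weightA seedA.
Proof.
move=> tF; apply: (ccvg_cnorm_le (limP tF)) => k.
have -> : 4 * weightA seedA = 2 * (2 * weightA seedA) by rewrite mulrA -natrM.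
apply: (cnorm_sum_approx (@atom_weight_ge0 R n)
  (weight_prod_atom d_ge0 d_le1) d_small P_ge0) => //.
Qed.

Lemma sum_pairs (X Y : seq atom) (F G : atom -> R[i]) :
  \sum_(a <- X) \sum_(b <- Y) F a * G b = (\sum_(a <- X) F a) * (\sum_(b <- Y) G b).
Proof. by rewrite big_distrlr. Qed.

Let stepE (F : atom -> R[i]) k : S F k.+1 = \sum_(t <- seedA) F t +
  \sum_(a <- approx (prod_atom d) seedA k) \sum_(b <- approx (prod_atom d) seedA k)
     \sum_(t <- prod_atom d a b) F t.
Proof. by rewrite -sum_bilin sum_approxS. Qed.

Let sum_Inv0 (F : atom -> R[i]) : (forall k p c, F (Inv k p c) = 0) ->
  \sum_(t <- [seq Inv k 0 (cinv k) | k <- enum 'I_n]) F t = 0.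
Proof. by move=> F0; rewrite big_map big1. Qed.

Let seedE (F : atom -> R[i]) : (forall k p c, F (Inv k p c) = 0) ->
  \sum_(t <- seedA) F t =
  F One + (F (Rot (Re (\sum_(k < n) cinv k))) + F (Rel 1 1)).
Proof. by move=> F0; rewrite !big_cons sum_Inv0 // addr0. Qed.

Lemma lim_One : L (@eOne R n) = 1.
Proof.
apply: (ccvg_unique (ccvg_shift (limP weight_bounded_One))).
under eq_fun do rewrite stepE seedE //.
have e k : \sum_(a <- approx (prod_atom d) seedA k)
    \sum_(b <- approx (prod_atom d) seedA k)
     \sum_(t <- prod_atom d a b) eOne t = 0 :> R[i].
  by apply: big1 => a _; apply: big1 => b _; rewrite sum_prod_eOne.
under eq_fun do rewrite e /= !addr0.
exact: ccvg_cst.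
Qed.

Lemma lim_Rel s : L (eRel s) = cis s + (d ^+ 2)%:C * L (eDev s).
Proof.
apply: (ccvg_unique (ccvg_shift (limP (weight_bounded_Rel s)))).
have e k : S (eRel s) k.+1 = cis s +
    (d ^+ 2)%:C * (S (@eOne R n) k * S (eDev s) k).
  rewrite stepE seedE //= !add0r mul1r harm1 -sum_pairs mulr_sumr; congr (_ + _).
  apply: eq_bigr => a _; rewrite mulr_sumr; apply: eq_bigr => b _.
  exact: sum_prod_eRel.
under eq_fun do rewrite e.
rewrite -[L (eDev s)]mul1r -lim_One.
apply: ccvgD; first exact: ccvg_cst.
apply: ccvgM; first exact: ccvg_cst.
by apply: ccvgM; apply: limP; [exact: weight_bounded_One|exact: weight_bounded_Dev].
Qed.

Lemma lim_Rec s : L (eRec s) = d%:C * L (eBeta s)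
  - (d ^+ 2)%:C * (L (eRec s) * L (eBeta s)).
Proof.
apply: (ccvg_unique (ccvg_shift (limP (weight_bounded_Rec s)))).
have e k : S (eRec s) k.+1 = d%:C * (S (@eOne R n) k * S (eBeta s) k) +
    (- (d ^+ 2)%:C) * (S (eRec s) k * S (eBeta s) k).
  rewrite stepE seedE //= !add0r -!sum_pairs !mulr_sumr -big_split.
  apply: eq_bigr => a _; rewrite !mulr_sumr -big_split; apply: eq_bigr => b _.
  by rewrite /= sum_prod_eRec mulNr.
under eq_fun do rewrite e.
rewrite -[in d%:C * L (eBeta s)](mul1r (L (eBeta s))) -lim_One -mulNr.
apply: ccvgD; (apply: ccvgM; first exact: ccvg_cst).
  by apply: ccvgM; apply: limP; [exact: weight_bounded_One|exact: weight_bounded_Beta].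
by apply: ccvgM; apply: limP; [exact: weight_bounded_Rec|exact: weight_bounded_Beta].
Qed.

Definition limDiff k s : R[i] :=
  L (eRel s) - cis (2 * theta n k) * L (eRel (s - theta n k)).

Let cvg_eDiff k s : ccvg (fun l => S (eDiff k s) l) (limDiff k s).
Proof.
have e l : S (eDiff k s) l = S (eRel s) l +
    (- cis (2 * theta n k)) * S (eRel (s - theta n k)) l.
  rewrite mulr_sumr -big_split; apply: eq_bigr => t _.
  by rewrite /= /eDiff mulNr.
under eq_fun do rewrite e.
rewrite /limDiff -[- (cis _ * _)]mulNr; apply: ccvgD; first exact/limP/weight_bounded_Rel.
by apply: ccvgM; [exact: ccvg_cst|exact/limP/weight_bounded_Rel].
Qed.

Lemma lim_Inv k s : L (eInv k s) = cinv k
  - (d ^+ 2)%:C * (cinv k * (L (eInv k s) * limDiff k s)).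
Proof.
apply: (ccvg_unique (ccvg_shift (limP (weight_bounded_Inv k s)))).
have e l : S (eInv k s) l.+1 = cinv k +
    (- ((d ^+ 2)%:C * cinv k)) * (S (eInv k s) l * S (eDiff k s) l).
  rewrite stepE; congr (_ + _).
    rewrite !big_cons /= !add0r big_map (bigD1_seq k) ?mem_enum ?enum_uniq //=.
    rewrite eqxx harm0 mulr1 big1 ?addr0 // => j kj.
    by rewrite (negPf kj).
  rewrite -sum_pairs mulr_sumr; apply: eq_bigr => a _.
  rewrite mulr_sumr; apply: eq_bigr => b _.
  by rewrite sum_prod_eInv mulNr mulrA.
under eq_fun do rewrite e.
rewrite mulrA -[- (_ * (_ * limDiff k s))]mulNr.
apply: ccvgD; first exact: ccvg_cst.
apply: ccvgM; first exact: ccvg_cst.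
by apply: ccvgM; [exact/limP/weight_bounded_Inv|exact: cvg_eDiff].
Qed.

Definition limForcing s : R[i] :=
  \sum_(k < n) cinv k * (L (eInv k s) * limDiff k s).

Lemma lim_Lin s :
  'i%C * conjc (L (eDev' s)) + cis (- s) * L (eBeta s) + 2%:C * L (@eRot R n) =
  2%:C * (Re (\sum_(k < n) cinv k))%:C +
  (d%:C * (cis (- s) * (L (eRec s) * L (eBeta s)))
  - (2 * d ^+ 2)%:C * (L (@eRot R n) * L (eRel (- s)))
  - (d ^+ 2)%:C * (limForcing s + conjc (limForcing (- s)))).
Proof.
have cl : ccvg (fun k => S (eLin s) k) ('i%C * conjc (L (eDev' s)) +
    cis (- s) * L (eBeta s) + 2%:C * L (@eRot R n)).
  have e k : S (eLin s) k = 'i%C * conjc (S (eDev' s) k) +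
      cis (- s) * S (eBeta s) k + 2%:C * S (@eRot R n) k.
    have -> : conjc (S (eDev' s) k) =
        \sum_(t <- approx (prod_atom d) seedA k) conjc (eDev' s t).
      exact: conjc_sum.
    rewrite !mulr_sumr -!big_split; apply: eq_bigr => t _.
    by [].
  under eq_fun do rewrite e.
  apply: ccvgD; first apply: ccvgD.
  - apply: ccvgM; first exact: ccvg_cst.
    by apply: ccvg_conj; exact/limP/weight_bounded_Dev'.
  - by apply: ccvgM; [exact: ccvg_cst|exact/limP/weight_bounded_Beta].
  - by apply: ccvgM; [exact: ccvg_cst|exact/limP/weight_bounded_Rot].
apply: (ccvg_unique (ccvg_shift cl)).
pose Fo s' k := \sum_(j < n) cinv j * (S (eInv j s') k * S (eDiff j s') k).
have FoE s' k : \sum_(a <- approx (prod_atom d) seedA k)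
    \sum_(b <- approx (prod_atom d) seedA k) forcing s' a b = Fo s' k.
  rewrite /Fo.
  under [RHS]eq_bigr do rewrite -sum_pairs mulr_sumr.
  rewrite [RHS]exchange_big; apply: eq_bigr => a _ /=.
  under [RHS]eq_bigr do rewrite mulr_sumr.
  by rewrite [RHS]exchange_big.
have e k : S (eLin s) k.+1 = 2%:C * (Re (\sum_(k < n) cinv k))%:C +
    (d%:C * (cis (- s) * (S (eRec s) k * S (eBeta s) k))
    + (- (2 * d ^+ 2)%:C) * (S (@eRot R n) k * S (eRel (- s)) k)
    + (- (d ^+ 2)%:C) * (Fo s k + conjc (Fo (- s) k))).
  rewrite stepE seedE; last by move=> *; rewrite eLin0.
  rewrite eLin_Rot !eLin0 // add0r addr0; congr (_ + _).
  rewrite -!FoE -!sum_pairs.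
  have -> : conjc (\sum_(a <- approx (prod_atom d) seedA k)
      \sum_(b <- approx (prod_atom d) seedA k) forcing (- s) a b) =
      \sum_(a <- approx (prod_atom d) seedA k)
      \sum_(b <- approx (prod_atom d) seedA k) conjc (forcing (- s) a b).
    rewrite conjc_sum; apply: eq_bigr => a _.
    exact: conjc_sum.
  rewrite -big_split !mulr_sumr -!big_split; apply: eq_bigr => a _ /=.
  rewrite -big_split !mulr_sumr -!big_split; apply: eq_bigr => b _ /=.
  by rewrite sum_prod_eLin // !mulNr.
under eq_fun do rewrite e.
have cF s' : ccvg (Fo s') (limForcing s').
  apply: ccvg_sum => j; apply: ccvgM; first exact: ccvg_cst.
  by apply: ccvgM; [exact/limP/weight_bounded_Inv|exact: cvg_eDiff].
apply: ccvgD; first exact: ccvg_cst.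
rewrite -!mulNr; apply: ccvgD; first apply: ccvgD.
- apply: ccvgM; first exact: ccvg_cst.
  apply: ccvgM; first exact: ccvg_cst.
  by apply: ccvgM; [exact/limP/weight_bounded_Rec|exact/limP/weight_bounded_Beta].
- apply: ccvgM; first exact: ccvg_cst.
  by apply: ccvgM; [exact/limP/weight_bounded_Rot|exact/limP/weight_bounded_Rel].
- apply: ccvgM; first exact: ccvg_cst.
  by apply: ccvgD; [exact: cF|apply: ccvg_conj; exact: cF].
Qed.

Lemma lim_Beta s : L (eBeta s) = cis (- s) * ((L (eDev s) - L (eDev (s - pi))) / 2).
Proof.
apply: (ccvg_unique (limP (weight_bounded_Beta s))).
have e k : S (eBeta s) k =
    cis (- s) * ((S (eDev s) k + (-1) * S (eDev (s - pi)) k) * 2^-1).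
  rewrite mulr_sumr -big_split mulr_suml mulr_sumr; apply: eq_bigr => t _.
  by rewrite /= eBetaE mulN1r.
under eq_fun do rewrite e.
rewrite -[- L _]mulN1r.
apply: ccvgM; first exact: ccvg_cst.
apply: ccvgM; last exact: ccvg_cst.
apply: ccvgD; first exact/limP/weight_bounded_Dev.
by apply: ccvgM; [exact: ccvg_cst|exact/limP/weight_bounded_Dev].
Qed.

Lemma lim_Rel_conj s : conjc (L (eRel s)) = L (eRel (- s)).
Proof.
apply: (ccvg_unique (ccvg_conj (limP (weight_bounded_Rel s)))).
have e k : conjc (S (eRel s) k) = S (eRel (- s)) k.
  rewrite conjc_sum; apply: eq_bigr => t _; exact: conj_eRel.
under eq_fun do rewrite e.
exact/limP/weight_bounded_Rel.
Qed.

Lemma lim_Rot_conj : conjc (L (@eRot R n)) = L (@eRot R n).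
Proof.
apply: (ccvg_unique (ccvg_conj (limP weight_bounded_Rot))).
have e k : conjc (S (@eRot R n) k) = S (@eRot R n) k.
  rewrite conjc_sum; apply: eq_bigr => t _; exact: conj_eRot.
under eq_fun do rewrite e.
exact/limP/weight_bounded_Rot.
Qed.

Lemma lim_Dev_period s : L (eDev (s + 2 * pi)) = L (eDev s).
Proof.
apply: (ccvg_unique (limP (weight_bounded_Dev _))).
have e k : S (eDev (s + 2 * pi)) k = S (eDev s) k.
  by apply: eq_bigr => t _; exact: eDev_period.
under eq_fun do rewrite e.
exact/limP/weight_bounded_Dev.
Qed.

Lemma lim_Dev_deriv s : cderiv (fun x => L (eDev x)) s (L (eDev' s)).
Proof.
apply: (@cderiv_quadratic _ _ _ _ (4 * (2 * weightA seedA))) => h.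
have cv : ccvg (fun k => S (eDev (s + h)) k + (-1) * S (eDev s) k +
    (- h%:C) * S (eDev' s) k)
    (L (eDev (s + h)) + (-1) * L (eDev s) + (- h%:C) * L (eDev' s)).
  apply: ccvgD; first apply: ccvgD; first exact/limP/weight_bounded_Dev.
    by apply: ccvgM; [exact: ccvg_cst|exact/limP/weight_bounded_Dev].
  by apply: ccvgM; [exact: ccvg_cst|exact/limP/weight_bounded_Dev'].
rewrite mulN1r mulNr in cv.
apply: (ccvg_cnorm_le cv) => k; rewrite mulN1r mulNr.
have -> : S (eDev (s + h)) k - S (eDev s) k - h%:C * S (eDev' s) k =
    \sum_(t <- approx (prod_atom d) seedA k)
      (eDev (s + h) t - eDev s t - h%:C * eDev' s t).
  by rewrite !sumrB mulr_sumr.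
have -> : 4 * (2 * weightA seedA) * h ^+ 2 = 4 * h ^+ 2 * (2 * weightA seedA) by ring.
apply: (cnorm_sum_approx (@atom_weight_ge0 R n)
  (weight_prod_atom d_ge0 d_le1) d_small P_ge0).
  by rewrite mulr_ge0 // sqr_ge0.
by move=> t; exact: taylor_Dev.
Qed.

(** The iteration read on functions: each evaluation of B is a product of two
evaluations, and products pass to the limit. *)
Theorem limit_system :
  exists (Om : R) (G G' B Q : R -> R[i]) (V : 'I_n -> R -> R[i]),
  let W s := cis s + (d ^+ 2)%:C * G s in
  let D (k : 'I_n) s := W s - cis (2 * theta n k) * W (s - theta n k) in
  let F s := \sum_(k < n) cinv k * (V k s * D k s) in
  [/\ forall s, B s = cis (- s) * ((G s - G (s - pi)) / 2),
      forall s, Q s = d%:C * B s - (d ^+ 2)%:C * (Q s * B s),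
      forall k s, V k s = cinv k
         - (d ^+ 2)%:C * (cinv k * (V k s * D k s)),
      forall s, 'i%C * conjc (G' s) + cis (- s) * B s + 2%:C * Om%:C =
        2%:C * (Re (\sum_(k < n) cinv k))%:C +
        (d%:C * (cis (- s) * (Q s * B s)) - (2 * d ^+ 2)%:C * (Om%:C * W (- s))
         - (d ^+ 2)%:C * (F s + conjc (F (- s)))) &
      [/\ forall s, conjc (W s) = W (- s),
          forall s, cderiv G s (G' s),
          forall s, G (s + 2 * pi) = G s,
          `|Om| <= 4 * weightA seedA &
          forall s, cnorm (G s) <= 4 * weightA seedA]].
Proof.
have RotE : L (@eRot R n) = (Re (L (@eRot R n)))%:C.
  have := lim_Rot_conj; case: (L _) => x y /= [/eqP]; rewrite eq_sym -subr_eq0 opprK.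
  by rewrite -mulr2n mulrn_eq0 /= => /eqP ->.
exists (Re (L (@eRot R n))), (fun s => L (eDev s)), (fun s => L (eDev' s)),
  (fun s => L (eBeta s)), (fun s => L (eRec s)), (fun k s => L (eInv k s)).
move=> W D F.
have WE s : W s = L (eRel s) by rewrite lim_Rel.
have DE k s : D k s = limDiff k s by rewrite /D !WE.
have FE s : F s = limForcing s by apply: eq_bigr => k _; rewrite DE.
split; first exact: lim_Beta.
- exact: lim_Rec.
- by move=> k s; rewrite DE; exact: lim_Inv.
- by move=> s; rewrite !FE WE -RotE; exact: lim_Lin.
split.
- by move=> s; rewrite !WE; exact: lim_Rel_conj.
- exact: lim_Dev_deriv.
- exact: lim_Dev_period.
- have := limB weight_bounded_Rot; apply: le_trans; exact: normr_Re_le.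
- by move=> s; exact/limB/weight_bounded_Dev.
Qed.

End Limit.

(** * The profile of a tight pair *)

Section Profile.
Context {R : realType}.

Lemma theta_lt (n k : nat) : (0 < k)%N -> (k < n)%N ->
  0 < (theta n k : R) < 2 * pi.
Proof.
move=> k0 kn; have n0 : 0 < n%:R :> R by rewrite ltr0n (leq_trans _ kn).
have pi0 := @pi_gt0 R.
rewrite /theta; apply/andP; split; first by rewrite divr_gt0 // mulr_gt0 ?ltr0n // mulr_gt0.
by rewrite ltr_pdivrMr // mulrC ltr_pM2l ?mulr_gt0 // ltr_nat.
Qed.

Lemma theta_half (n : nat) : ~~ odd n -> (0 < n)%N -> theta n n./2 = pi :> R.
Proof.
move=> ne n0; rewrite /theta.
have -> : n%:R = 2 * n./2%:R :> R by rewrite -natrM mul2n even_halfK.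
field; rewrite ?pnatr_eq0 -?lt0n //; lia.
Qed.

(** The m-gon has m distinct vertices: 2 theta_k is a multiple of 2 pi only
for k = 0 and k = n / 2. *)
Lemma cis_2theta_neq1 (n k : nat) : ~~ odd n -> (0 < k)%N -> (k < n)%N ->
  k != n./2 -> cis (2 * theta n k) != 1 :> R[i].
Proof.
move=> ne k0 kn km; have n0 : 0 < n%:R :> R by rewrite ltr0n (leq_trans _ kn).
have pi0 := @pi_gt0 R.
have nE : n%:R = 2 * n./2%:R :> R by rewrite -natrM mul2n even_halfK.
have tE : 2 * theta n k * n./2%:R = k%:R * (2 * pi) :> R.
  rewrite /theta nE; field; rewrite pnatr_eq0 -lt0n; lia.
have m0 : 0 < n./2%:R :> R by rewrite ltr0n; lia.
have [lt_km|lt_mk|/eqP] := ltngtP k n./2; last by rewrite (negPf km).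
  apply: cis_neq1; rewrite -(ltr_pM2r m0) -[X in _ && X](ltr_pM2r m0) mul0r tE.
  by rewrite mulr_gt0 ?ltr0n ?mulr_gt0 //= mulrC ltr_pM2l ?mulr_gt0 // ltr_nat.
rewrite -[2 * _](subrK (2 * pi)) cisD cis_2pi mulr1; apply: cis_neq1.
rewrite -(ltr_pM2r m0) -[X in _ && X](ltr_pM2r m0) mul0r mulrBl tE.
rewrite (mulrC (2 * pi)) -mulrBl mulr_gt0 ?mulr_gt0 ?subr_gt0 ?ltr_nat //=.
rewrite ltr_pM2r ?mulr_gt0 // ltrBlDr -natrD ltr_nat; lia.
Qed.

Lemma theta0 n : theta n 0 = 0 :> R.
Proof. by rewrite /theta !mul0r. Qed.

Lemma theta_sub (n k : nat) : (k <= n)%N -> (0 < n)%N ->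
  theta n (n - k) = 2 * pi - theta n k :> R.
Proof.
move=> kn n0; rewrite /theta natrB //; field.
by rewrite pnatr_eq0 -lt0n.
Qed.

Definition opp_ord n (k : 'I_n) : 'I_n :=
  Ordinal (ltn_pmod (n - k) (leq_ltn_trans (leq0n k) (ltn_ord k))).

Lemma opp_ordE n (k : 'I_n) :
  nat_of_ord (opp_ord k) = if nat_of_ord k == 0%N then 0%N else (n - k)%N.
Proof.
rewrite /=; case: eqP => [->|/eqP k0]; first by rewrite subn0 modnn.
by rewrite modn_small // ltn_subrL lt0n k0 (leq_ltn_trans _ (ltn_ord k)).
Qed.

Lemma opp_ord_inj n : injective (@opp_ord n).
Proof.
move=> j k /(congr1 (@nat_of_ord n)); rewrite !opp_ordE => e; apply/val_inj => /=.
by have := ltn_ord j; have := ltn_ord k; move: e; do !case: eqP; lia.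
Qed.

Lemma theta_opp n (k : 'I_n) : exists p : int,
  theta n (opp_ord k) = p%:~R * (2 * pi) - theta n k :> R.
Proof.
rewrite opp_ordE; case: eqP => [->|/eqP k0].
  by exists 0; rewrite theta0 mul0r subrr.
have kn := ltn_ord k; exists 1.
by rewrite mul1r theta_sub ?(ltnW kn) // (leq_ltn_trans _ kn).
Qed.

Lemma half_lt n : (0 < n)%N -> (n./2 < n)%N.
Proof. lia. Qed.

Definition half_ord n (n0 : (0 < n)%N) : 'I_n := Ordinal (half_lt n0).

Lemma half_ord_neq0 n (n0 : (0 < n)%N) : ~~ odd n ->
  nat_of_ord (half_ord n0) != 0%N.
Proof. by rewrite /= -lt0n half_gt0; case: n n0 => [|[|n]]. Qed.

Lemma opp_ord_eq_half n (n0 : (0 < n)%N) (k : 'I_n) : ~~ odd n ->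
  (opp_ord k == half_ord n0) = (k == half_ord n0).
Proof.
move=> ne; rewrite -!val_eqE [val (opp_ord k)]opp_ordE /=.
have := even_halfK ne; have := ltn_ord k; rewrite -muln2.
move: (nat_of_ord k) n./2 => j h jn nE.
by case: (j =P 0%N) => j0; apply/eqP/eqP; lia.
Qed.

Lemma opp_ord_eq0 n (k : 'I_n) :
  (nat_of_ord (opp_ord k) == 0%N) = (nat_of_ord k == 0%N).
Proof.
rewrite opp_ordE; have := ltn_ord k; move: (nat_of_ord k) => j jn.
by case: (j =P 0%N) => j0; apply/eqP/eqP; lia.
Qed.

(** The profile equation. The field [pr_inv] also says that two distinct
vortices never meet. The bound M on the rotation speed is independent of e in
[profile_exists]. *)
Record profile (n : nat) (e : R) (M : R) := Profile {
  pr_Om : R;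
  pr_w : R -> R[i];
  pr_w' : R -> R[i];
  pr_v : 'I_n -> R -> R[i];
  pr_Om_le : `|pr_Om| <= M;
  pr_deriv : forall s, cderiv pr_w s (pr_w' s);
  pr_period : forall s, pr_w (s + 2 * pi) = pr_w s;
  pr_inv : forall (k : 'I_n) s, k != 0%N :> nat ->
    pr_v k s * ((1 + e%:C * pr_w s) -
      cis (2 * theta n k) * (1 + e%:C * pr_w (s - theta n k))) = 1;
  pr_eq : forall s, 'i%C * conjc (pr_w' s) =
    (2 * e)%:C * (\sum_(k < n | k != 0%N :> nat) pr_v k s
      - pr_Om%:C * conjc (1 + e%:C * pr_w s));
  pr_close : forall s, cnorm (pr_w s - cis s) <= 8^-1
}.

Lemma periodic_shift (f : R -> R[i]) : (forall s, f (s + 2 * pi) = f s) ->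
  forall (p : int) s, f (s + p%:~R * (2 * pi)) = f s.
Proof.
move=> fp; have nat_case (k : nat) s : f (s + k%:R * (2 * pi)) = f s.
  elim: k s => [|k IH] s; first by rewrite mul0r addr0.
  by rewrite -natr1 mulrDl mul1r addrA fp IH.
case=> k s; first exact: nat_case.
by rewrite NegzE mulrNz mulNr -{2}(subrK (k.+1%:R * (2 * pi)) s) nat_case.
Qed.

(** Take d = sqrt e in [limit_system]. The reciprocal 1 - d q of 1 + d ^ 2
beta gives the interaction v_(n/2) inside a pair. The other v_k sum to a
symmetric function, because conj (v_k (- s)) = v_(n - k) (s), so the
symmetrisation of F has no effect. *)
Theorem profile_exists (n : nat) : ~~ odd n -> (0 < n)%N ->
  exists (e0 M : R), [/\ 0 < e0, 0 <= M &
    forall e, 0 < e -> e <= e0 -> inhabited (profile n e M)].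
Proof.
move=> ne n0; pose wA := weight (@atom_weight R n) (@seed R n).
have wA0 : 0 <= wA by apply: sumr_ge0 => a _; exact: atom_weight_ge0.
have pb0 : 0 <= prod_bound (R := R) (n := n).
  by rewrite addr_ge0 // mulr_ge0 // cinv_bound_ge0.
pose K := 4 * wA; have K0 : 0 <= K by rewrite mulr_ge0.
(* The three terms bound d, make the iteration a contraction, and keep w within
   1 / 8 of cis. *)
pose d0 : R := (1 + 8 * (prod_bound (R := R) (n := n) * wA) + 8 * K)^-1.
have pw0 : 0 <= prod_bound (R := R) (n := n) * wA by exact: mulr_ge0.
have den0 : 0 < 1 + 8 * (prod_bound (R := R) (n := n) * wA) + 8 * K by lra.
have d00 : 0 < d0 by rewrite invr_gt0.
exists (d0 ^+ 2), K; split => //; first exact: exprn_gt0.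
move=> e e0 ed0.
pose d := Num.sqrt e.
have d_gt0 : 0 < d by rewrite sqrtr_gt0.
have dE : d ^+ 2 = e by rewrite sqr_sqrtr // ltW.
have dd0 : d <= d0.
  by rewrite -(ger0_norm (ltW d00)) -sqrtr_sqr; exact: ler_wsqrtr.
have ddt (x : R) : 0 <= x -> x <= 1 + 8 * (prod_bound (R := R) (n := n) * wA) + 8 * K ->
    d * x <= 1.
  move=> x0 xl; apply: (@le_trans _ _ (d0 * x)); first exact: ler_wpM2r.
  by rewrite mulrC -[x * d0]/(x / _) ler_pdivrMr // mul1r.
have d1 : d <= 1 by rewrite -[d]mulr1; apply: ddt; lra.
have dsmall : 8 * (d * prod_bound (n := n) * weight (@atom_weight R n) (@seed R n)) <= 1.
  have -> : 8 * (d * prod_bound (n := n) * weight (@atom_weight R n) (@seed R n)) =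
    d * (8 * (prod_bound (n := n) * wA)) by rewrite /wA; ring.
  by apply: ddt; lra.
have dK : d ^+ 2 * K <= 8^-1.
  have h : d * (8 * K) <= 1 by apply: ddt; lra.
  have h2 : d ^+ 2 * K <= d * K by rewrite ler_wpM2r // expr2 ler_piMr // ltW.
  by lra.
have [Om [G [G' [B [Q [V []]]]]]] := limit_system (ltW d_gt0) d1 dsmall.
rewrite dE => B_eq Q_eq V_eq L_eq [W_conj G_deriv G_per Om_le G_le].
pose W s := cis s + e%:C * G s.
pose D (k : 'I_n) s := W s - cis (2 * theta n k) * W (s - theta n k).
have eC : e%:C != 0 by rewrite (inj_eq (@complexI _) e 0) gt_eqF.
pose m := half_ord n0.
pose rho s := 1 - d%:C * Q s.
have rhoE s : rho s * (1 + e%:C * B s) = 1.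
  have dd : e%:C = d%:C * d%:C :> R[i] by rewrite -rmorphM -expr2 dE.
  have := Q_eq s; rewrite /rho dd => q.
  have {}q : Q s * (1 + d%:C * d%:C * B s) = d%:C * B s.
    by rewrite mulrDr mulr1 {1}q; ring.
  have -> : (1 - d%:C * Q s) * (1 + d%:C * d%:C * B s) =
    1 + d%:C * d%:C * B s - d%:C * (Q s * (1 + d%:C * d%:C * B s)) by ring.
  by rewrite q; ring.
pose v (k : 'I_n) s : R[i] :=
  if k == m then cis (- s) * rho s / (2 * e)%:C else V k s.
have e2 : (2 * e)%:C != 0 :> R[i].
  by rewrite (inj_eq (@complexI _) _ 0) mulf_neq0 // gt_eqF.
have cinv_m : cinv (R := R) m = 0.
  by rewrite /cinv /= theta_half // cis_2pi subrr invr0.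
have cinv_0 (k : 'I_n) : k = 0%N :> nat -> cinv (R := R) k = 0.
  by move=> k0; rewrite /cinv k0 theta0 mulr0 cis0 subrr invr0.
have V0 (k : 'I_n) s : cinv (R := R) k = 0 -> V k s = 0.
  by move=> c0; rewrite V_eq c0 mul0r mulr0 subrr.
have v_inv (k : 'I_n) s : k != 0%N :> nat -> v k s * ((1 + e%:C * W s) -
      cis (2 * theta n k) * (1 + e%:C * W (s - theta n k))) = 1.
  move=> k0; rewrite /v; case: eqP => [->|/eqP km].
    rewrite /= theta_half // cis_2pi mul1r /W.
    have -> : cis (s - pi) = - cis s :> R[i].
      by rewrite cisD -conj_cis cis_pi rmorphN1 mulrN1.
    have GE : e%:C * G s - e%:C * G (s - pi) = 2 * e%:C * (cis s * B s).
      by rewrite B_eq (mulrA (cis s)) -cisD subrr cis0 mul1r; field.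
    have -> : 1 + e%:C * (cis s + e%:C * G s) -
        (1 + e%:C * (- cis s + e%:C * G (s - pi))) =
        (2 * e)%:C * cis s * (1 + e%:C * B s).
      have -> : 1 + e%:C * (cis s + e%:C * G s) -
          (1 + e%:C * (- cis s + e%:C * G (s - pi))) =
          2 * e%:C * cis s + e%:C * (e%:C * G s - e%:C * G (s - pi)) by ring.
      by rewrite GE rmorphM /= rmorph_nat; ring.
    have -> : cis (- s) * rho s / (2 * e)%:C *
        ((2 * e)%:C * cis s * (1 + e%:C * B s)) =
      (cis (- s) * cis s) * (rho s * (1 + e%:C * B s)) * ((2 * e)%:C / (2 * e)%:C).
      by ring.
    by rewrite cisN_mul rhoE mulfV // !mulr1.
  have mu0 : 1 - cis (2 * theta n k) != 0 :> R[i].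
    by rewrite subr_eq0 eq_sym cis_2theta_neq1 // lt0n.
  have := V_eq k s; rewrite -/(W _) -/(W _) -/(D k s) /cinv => q.
  have {}q : V k s * (1 - cis (2 * theta n k) + e%:C * D k s) = 1.
    have := congr1 (fun x => x * (1 - cis (2 * theta n k))) q.
    rewrite mulrBl mulVf // => q'.
    rewrite mulrDr q'.
    have -> : e%:C * ((1 - cis (2 * theta n k))^-1 * (V k s * D k s)) *
      (1 - cis (2 * theta n k)) = e%:C * (V k s * D k s) *
      ((1 - cis (2 * theta n k))^-1 * (1 - cis (2 * theta n k))) by ring.
    by rewrite mulVf // mulr1; ring.
  by rewrite -[RHS]q /D; congr (_ * _); ring.
have W_per s : W (s + 2 * pi) = W s by rewrite /W G_per cisD cis_2pi mulr1.
have W_shift := periodic_shift W_per.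
(* Both sides invert the same number, since w is symmetric. *)
have V_conj (k : 'I_n) s : conjc (V k (- s)) = V (opp_ord k) s.
  have [k0|k0] := eqVneq (k : nat) 0%N.
    rewrite !V0 ?conjc0 //; apply: cinv_0 => //.
    by apply/eqP; rewrite opp_ord_eq0 k0.
  have [km|km] := eqVneq k m.
    rewrite !V0 ?conjc0 ?km //.
    by rewrite (_ : opp_ord m = m) //; apply/eqP; rewrite opp_ord_eq_half.
  have ok0 : opp_ord k != 0%N :> nat by rewrite opp_ord_eq0.
  have okm : opp_ord k != m by rewrite opp_ord_eq_half.
  have h1 := v_inv k (- s) k0; rewrite /v (negPf km) in h1.
  have h2 := v_inv (opp_ord k) s ok0; rewrite /v (negPf okm) in h2.
  have [p tp] := theta_opp k.
  have cR x : conjc x%:C = x%:C :> R[i] by rewrite conjc_real.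
  have := congr1 (@conjc _) h1; rewrite conjc_mul conjc1.
  rewrite conjc_sub conjc_mul !conjc_add !conjc_mul conjc1 !cR !W_conj conj_cis !opprK.
  have -> : - (- s - theta n k) = s + theta n k by ring.
  move=> h3.
  rewrite tp in h2.
  have c2 : cis (2 * (p%:~R * (2 * pi) - theta n k)) = cis (- (2 * theta n k)) :> R[i].
    rewrite mulrBr cisD (_ : 2 * (p%:~R * (2 * pi)) = (2 * p)%:~R * (2 * pi)).
      by rewrite cis_int mul1r.
    by rewrite rmorphM /= -mulrA.
  have sE : s - (p%:~R * (2 * pi) - theta n k) =
      s + theta n k + (- p)%:~R * (2 * pi) by rewrite rmorphN /=; ring.
  rewrite c2 sE W_shift in h2.
  move: h2 h3; set den := (X in _ * X) => h2 h3.
  by rewrite -[LHS]mulr1 -h2 mulrCA h3 mulr1.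
pose Om0 := Re (\sum_(k < n) cinv (R := R) k).
pose F s := \sum_(k < n) cinv (R := R) k * (V k s * D k s).
have FE s : e%:C * F s = \sum_(k < n) cinv (R := R) k - \sum_(k < n) V k s.
  rewrite mulr_sumr -sumrB; apply: eq_bigr => k _.
  by rewrite {2}V_eq opprB addrC subrK.
have FF s : e%:C * (F s + conjc (F (- s))) = 2 * Om0%:C - 2 * \sum_(k < n) V k s.
  have -> : e%:C * (F s + conjc (F (- s))) = e%:C * F s + conjc (e%:C * F (- s)).
    by rewrite conjc_mul conjc_real mulrDr.
  rewrite !FE conjc_sub.
  have -> : conjc (\sum_(k < n) V k (- s)) = \sum_(k < n) V k s.
    rewrite conjc_sum [RHS](reindex_inj (@opp_ord_inj n)).
    by apply: eq_bigr => k _; exact: V_conj.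
  rewrite /Om0 -addcJ; ring.
have sum_v s : \sum_(k < n | k != 0%N :> nat) v k s =
    cis (- s) * rho s / (2 * e)%:C + \sum_(k < n) V k s.
  have m_neq0 : nat_of_ord m != 0%N by exact: half_ord_neq0.
  rewrite (bigD1 m) //= {1}/v eqxx; congr (_ + _).
  rewrite [RHS](bigID (fun k : 'I_n => (k != 0%N :> nat) && (k != m))) /=.
  rewrite [X in _ = _ + X]big1 ?addr0; last first.
    move=> k; rewrite negb_and !negbK => /orP[/eqP k0|/eqP ->]; apply: V0 => //.
    exact: cinv_0.
  by apply: eq_bigr => k /andP[_ km]; rewrite /v (negPf km).
constructor; refine (@Profile n e K Om W (fun s => 'i%C * cis s + e%:C * G' s) v
  Om_le _ W_per v_inv _ _).
- move=> s; apply: cderivD; first exact: cderiv_cis.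
  have := cderivM (cderiv_cst e%:C s) (G_deriv s).
  by rewrite mul0r add0r.
- move=> s; rewrite sum_v.
  rewrite conjc_add conjc_mul conjc_i conj_cis conjc_mul conjc_real.
  have -> : conjc (1 + e%:C * W s) = 1 + e%:C * W (- s).
    by rewrite conjc_add conjc_mul conjc1 conjc_real W_conj.
  have iG : 'i%C * conjc (G' s) = 2 * Om0%:C - 2 * Om%:C - cis (- s) * B s +
     d%:C * (cis (- s) * (Q s * B s)) - 2 * e%:C * (Om%:C * W (- s)) -
     e%:C * (F s + conjc (F (- s))).
    have two : 2%:C = 2 :> R[i] by rewrite rmorph_nat.
    have := L_eq s; rewrite -/(W _) -/(F s) -/(F (- s)) rmorphM /= two => l.
    apply: (addIr (cis (- s) * B s + 2 * Om%:C)); rewrite addrA l /Om0.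
    by ring.
  rewrite FF in iG.
  rewrite mulrDr (mulrCA _ e%:C) iG.
  have ii : 'i%C * (- 'i%C * cis (- s)) = cis (- s) :> R[i].
    by rewrite mulrA mulrN -expr2 sqr_i opprK mul1r.
  rewrite ii.
  have rE : e%:C * (- (cis (- s) * B s) + d%:C * (cis (- s) * (Q s * B s))) =
      cis (- s) * (rho s - 1).
    rewrite -[in RHS](rhoE s) /rho; ring.
  have divE (x y z : R[i]) :
      (2 * e)%:C * (x / (2 * e)%:C + y - z) = x + (2 * e)%:C * (y - z).
    by rewrite -addrA mulrDr mulrCA mulfV // mulr1.
  rewrite divE.
  have two : 2%:C = 2 :> R[i] by rewrite rmorph_nat.
  rewrite !rmorphM /= two.
  have -> : cis (- s) * rho s = cis (- s) + cis (- s) * (rho s - 1) by ring.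
  rewrite -rE; ring.
- move=> s; rewrite /W addrAC subrr add0r.
  apply: le_trans (cnormM _ _) _; rewrite cnorm_real gtr0_norm //.
  apply: le_trans dK; rewrite dE; apply: ler_wpM2l; first exact: ltW.
  exact: G_le.
Qed.

End Profile.

(** * The gradient of the Hamiltonian *)

Section Gradient.
Context {R : realType} {n : nat}.
Implicit Types (Z : 'M[R]_(n, 2)) (i j a b : 'I_n) (k : 'I_2).

Lemma sqdist_gt0 Z i j : ~ collisions Z -> i != j -> 0 < sqdist Z i j.
Proof.
move=> nc ij; rewrite lt_neqAle addr_ge0 ?sqr_ge0 // andbT eq_sym.
rewrite /sqdist paddr_eq0 ?sqr_ge0 // !sqrf_eq0 !subr_eq0.
apply/negP => /andP[/eqP e0 /eqP e1]; apply: nc.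
have rowE : row i Z = row j Z.
  apply/rowP => k; rewrite !mxE; case: k => [[|[|k]] kP] //.
    by rewrite (_ : Ordinal kP = 0) //; exact/val_inj.
  by rewrite (_ : Ordinal kP = 1) //; exact/val_inj.
have [lt_ij|lt_ji|/val_inj/eqP] := ltngtP i j; last by rewrite (negPf ij).
- by exists i, j.
- by exists j, i.
Qed.

Lemma sqdistC Z i j : sqdist Z i j = sqdist Z j i.
Proof. by rewrite /sqdist -sqrrN opprB -[in X in _ + X]sqrrN opprB. Qed.

Lemma is_derive_sqr_line (p c : R) :
  is_derive (0 : R) 1 (fun h => (p + h * c) ^+ 2) (2 * p * c).
Proof.
have l : is_derive (0 : R) 1 (fun h : R => p + h * c) c.
  rewrite (_ : (fun h : R => p + h * c) = (fun h => c * h + p)); last first.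
    by apply/funext => h; rewrite addrC mulrC.
  exact: is_derive_affine.
rewrite (_ : (fun h => (p + h * c) ^+ 2) = (fun h => p + h * c) * (fun h => p + h * c)).
  by apply: is_derive_eq; rewrite /GRing.scale /= mul0r addr0; ring.
by apply/funext => h; rewrite expr2.
Qed.

(** The increment of the l-th coordinate of z_a - z_b when the k-th coordinate
of z_i increases by 1. *)
Definition pair_incr i k a b (l : 'I_2) : R :=
  ((a == i) && (l == k))%:R - ((b == i) && (l == k))%:R.

(** Only the coordinate k of the difference z_a - z_b varies, and only when i
is one of the two ends. *)
Lemma is_derive_ln_sqdist Z i k a b : 0 < sqdist Z a b ->
  is_derive (0 : R) 1 (fun h => ln (sqdist (h *: delta_mx i k + Z) a b))
    (2 * (Z a k - Z b k) * ((a == i)%:R - (b == i)%:R) / sqdist Z a b).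
Proof.
move=> s0.
have sE : (fun h => sqdist (h *: delta_mx i k + Z) a b) =
    (fun h => (Z a 0 - Z b 0 + h * pair_incr i k a b 0) ^+ 2) +
    (fun h => (Z a 1 - Z b 1 + h * pair_incr i k a b 1) ^+ 2).
  apply/funext => h; rewrite /sqdist !mxE /pair_incr; congr (_ ^+ 2 + _ ^+ 2); ring.
have d := is_deriveD (is_derive_sqr_line (Z a 0 - Z b 0) (pair_incr i k a b 0))
  (is_derive_sqr_line (Z a 1 - Z b 1) (pair_incr i k a b 1)).
rewrite -sE in d.
have s0' : 0 < sqdist ((0 : R) *: delta_mx i k + Z) a b by rewrite scale0r add0r.
have dl := is_derive1_ln s0'.
apply: (is_derive_eq (@is_derive1_comp _ (@ln R)
  (fun h => sqdist (h *: delta_mx i k + Z) a b) 0 _ _ dl d)).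
rewrite scale0r add0r mulrC; congr (_ / _).
rewrite /pair_incr; case: k {sE d s0' dl} => [[|[|k]] kP] //.
  rewrite (_ : Ordinal kP = 0); last exact/val_inj.
  by rewrite eqxx !andbT !andbF subrr mulr0 addr0.
rewrite (_ : Ordinal kP = 1); last exact/val_inj.
by rewrite eqxx !andbT !andbF subrr mulr0 add0r.
Qed.

Lemma derive_line (f : 'M[R]_(n, 2) -> R) Z V c :
  is_derive (0 : R) 1 (fun h => f (h *: V + Z)) c -> 'D_V f Z = c.
Proof.
move=> [_ <-]; rewrite /derive.
have -> : (fun h : R => h^-1 *: ((f \o shift Z) (h *: V) - f Z)) =
    (fun h : R => h^-1 *: (((fun x : R => f (x *: V + Z)) \o shift 0) (h *: (1 : R))
      - f (0 *: V + Z))).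
  apply/funext => h; rewrite scale0r add0r /=.
  by rewrite [h *: 1]mulr1 addr0.
by [].
Qed.

Lemma is_derive_bigsum (I : Type) (r : seq I) (P : pred I) (f : I -> R -> R)
    (c : I -> R) : (forall x, P x -> is_derive (0 : R) 1 (f x) (c x)) ->
  is_derive (0 : R) 1 (fun h => \sum_(x <- r | P x) f x h) (\sum_(x <- r | P x) c x).
Proof.
move=> fc; elim: r => [|x r IH].
  rewrite big_nil; under eq_fun do rewrite big_nil.
  exact: is_derive_cst.
rewrite big_cons; under eq_fun do rewrite big_cons.
by case: ifP => // Px; exact: (is_deriveD (fc x Px) IH).
Qed.

(** A vortex i occurs in the pairs (i, b) with i < b and (a, i) with a < i;
both contribute the same expression. *)
Lemma gradientE Z i k : ~ collisions Z -> gradient hamiltonian Z i k =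
  - (2 * pi)^-1 * \sum_(j < n | j != i) (Z i k - Z j k) / sqdist Z i j.
Proof.
move=> nc; rewrite mxE.
pose U j := 2 * (Z i k - Z j k) / sqdist Z i j.
pose T a b := 2 * (Z a k - Z b k) * ((a == i)%:R - (b == i)%:R) / sqdist Z a b.
have dsum : is_derive (0 : R) 1 (fun h => hamiltonian (h *: delta_mx i k + Z))
    (- (4 * pi)^-1 * \sum_(a < n) \sum_(b < n | (a < b)%N) T a b).
  apply: (is_deriveZ (- (4 * pi)^-1)).
  apply: is_derive_bigsum => a _; apply: is_derive_bigsum => b ab.
  apply: is_derive_ln_sqdist; apply: sqdist_gt0 => //.
  by apply: contraTneq ab => ->; rewrite ltnn.
rewrite (derive_line dsum).
have -> : \sum_(a < n) \sum_(b < n | (a < b)%N) T a b = \sum_(j < n | j != i) U j.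
  have TE a b : (a < b)%N -> T a b = (if a == i then U b else 0) +
      (if b == i then U a else 0).
    move=> ab; rewrite /T /U; have [ai|ai] := eqVneq a i.
      have -> : (b == i) = false by apply/eqP => bi; rewrite ai bi ltnn in ab.
      by rewrite ai subr0 mulr1 addr0.
    have [->|bi] := eqVneq b i; last by rewrite subrr mulr0 mul0r addr0.
    by rewrite sub0r mulrN1 -mulrN opprB add0r sqdistC.
  under eq_bigr do under eq_bigr do rewrite TE //.
  under eq_bigr do rewrite big_split.
  rewrite big_split /= [RHS](bigID (fun j : 'I_n => (i < j)%N)) /=.
  congr (_ + _).
    rewrite (bigD1 i) //= eqxx [X in _ + X]big1 ?addr0; last first.
      by move=> a ai; apply: big1 => b _; rewrite (negPf ai).
    apply: eq_bigl => b; rewrite andbC.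
    by case: ltnP => //= ib; apply/esym/eqP => bi; rewrite bi ltnn in ib.
  rewrite (exchange_big_dep xpredT) //= (bigD1 i) //= [X in _ + X]big1 ?addr0; last first.
    by move=> b bi; apply: big1 => a _; rewrite (negPf bi).
  rewrite eqxx; apply: eq_bigl => a.
  by rewrite -leqNgt ltn_neqAle.
rewrite /U; have -> : - (4 * pi)^-1 * \sum_(j < n | j != i) 2 * (Z i k - Z j k) / sqdist Z i j
   = - (4 * pi)^-1 * 2 * \sum_(j < n | j != i) (Z i k - Z j k) / sqdist Z i j.
  rewrite -[RHS]mulrA [in RHS]mulr_sumr; congr (_ * _).
  by apply: eq_bigr => j _; rewrite mulrA.
have p0 : pi != 0 :> R by rewrite gt_eqF // pi_gt0.
have half (q : R) : q != 0 -> - (4 * q)^-1 * 2 = - (2 * q)^-1 by move=> q0; field.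
by rewrite half.
Qed.

Lemma JmxE (G : 'M[R]_(n, 2)) i : Jmx G i 0 = G i 1 /\ Jmx G i 1 = - G i 0.
Proof.
rewrite /Jmx !mxE !big_ord_recl !big_ord0 !mxE /=.
rewrite (_ : lift ord0 ord0 = 1) //; last exact/val_inj.
split; first by rewrite mulr0 mulr1 add0r addr0.
by rewrite mulr0 mulrN1 !addr0.
Qed.

End Gradient.

(** * The equations of motion in complex form *)

Section ComplexForm.
Context {R : realType} {n : nat}.

(** The curve in the phase space whose rows are the complex curves z_i. *)
Definition plane (z : 'I_n -> R -> R[i]) (t : R) : 'M[R]_(n, 2) :=
  \matrix_(i, k) if k == 0 then Re (z i t) else Im (z i t).

Lemma plane_Re z t i : plane z t i 0 = Re (z i t).
Proof. by rewrite mxE. Qed.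

Lemma plane_Im z t i : plane z t i 1 = Im (z i t).
Proof. by rewrite mxE. Qed.

Lemma plane_no_collision z t : (forall i j, i != j -> z i t != z j t) ->
  ~ collisions (plane z t).
Proof.
move=> inj [i [j [ij /rowP rowE]]].
have nij : i != j by apply: contraTneq ij => ->; rewrite ltnn.
move: (inj i j nij); rewrite eq_complex; have := rowE 0; have := rowE 1.
by rewrite !mxE /= => -> ->; rewrite !eqxx.
Qed.

Lemma Re_inv (w : R[i]) : Re w^-1 = Re w / (Re w ^+ 2 + Im w ^+ 2).
Proof. by case: w. Qed.

Lemma Im_inv (w : R[i]) : Im w^-1 = - Im w / (Re w ^+ 2 + Im w ^+ 2).
Proof. by case: w => a b; rewrite mulNr. Qed.

(** The conjugate of 1 / (z_i - z_j) is (z_i - z_j) / |z_i - z_j| ^ 2, so the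
symplectic gradient is this sum up to the factor i. *)
Lemma vortex_solutionP (z z' : 'I_n -> R -> R[i]) :
  (forall t i j, i != j -> z i t != z j t) ->
  (forall t i, cderiv (z i) t (z' i t)) ->
  (forall t i, conjc (z' i t) = - ('i%C * ((2 * pi)^-1)%:C) *
     \sum_(j < n | j != i) (z i t - z j t)^-1) ->
  vortex_solution (plane z).
Proof.
move=> inj dz zE t; have nc := plane_no_collision (inj t); split => //.
have Re_sum (P : pred 'I_n) (F : 'I_n -> R[i]) :
    Re (\sum_(j | P j) F j) = \sum_(j | P j) Re (F j).
  by elim/big_rec2: _ => // j x y _ <-; rewrite cRe_add.
have Im_sum (P : pred 'I_n) (F : 'I_n -> R[i]) :
    Im (\sum_(j | P j) F j) = \sum_(j | P j) Im (F j).
  by elim/big_rec2: _ => // j x y _ <-; rewrite cIm_add.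
have sqE i j : sqdist (plane z t) i j =
    Re (z i t - z j t) ^+ 2 + Im (z i t - z j t) ^+ 2.
  by rewrite /sqdist !mxE /=; case: (z i t) (z j t) => [? ?] [].
have entry i : is_derive t 1 (fun x => plane z x i 0)
       (Jmx (gradient hamiltonian (plane z t)) i 0) /\
     is_derive t 1 (fun x => plane z x i 1)
       (Jmx (gradient hamiltonian (plane z t)) i 1).
  have [-> ->] := JmxE (gradient hamiltonian (plane z t)) i.
  have [d0 d1] := dz t i.
  under eq_fun do rewrite plane_Re.
  under [X in _ /\ is_derive _ _ X _]eq_fun do rewrite plane_Im.
  have zc := zE t i; set c := (2 * pi)^-1 in zc *.
  have fE : - ('i%C * c%:C) = 0 +i* (- c) :> R[i].
    by apply/eqP; rewrite eq_complex /= !mul0r mulr0 mul1r subrr oppr0 add0r !eqxx.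
  rewrite {}fE in zc.
  split.
    apply: (is_derive_eq d0); rewrite gradientE // -(cRe_conj (z' i t)) zc.
    rewrite cRe_mul Re_sum Im_sum /= mul0r sub0r mulNr opprK mulNr -mulrN -sumrN; congr (_ * _); apply: eq_bigr => j _.
    rewrite Im_inv sqE !plane_Im -mulNr; congr (_ / _).
    by case: (z i t) (z j t) => [? ?] [].
  apply: (is_derive_eq d1); rewrite gradientE // -[LHS]opprK -(cIm_conj (z' i t)) zc.
  rewrite cIm_mul Re_sum Im_sum /= mul0r add0r mulNr opprK mulNr opprK.
  congr (_ * _); apply: eq_bigr => j _.
  rewrite Re_inv sqE !plane_Re; congr (_ / _).
  by case: (z i t) (z j t) => [? ?] [].
have entryk i k : is_derive t 1 (fun x => plane z x i k)
       (Jmx (gradient hamiltonian (plane z t)) i k).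
  have [e0 e1] := entry i.
  case: k => [[|[|k]] kP] //.
    by rewrite (_ : Ordinal kP = 0) //; exact/val_inj.
  by rewrite (_ : Ordinal kP = 1) //; exact/val_inj.
have dbl : derivable (plane z) t 1.
  by apply/derivable_mxP => i k; have [] := entryk i k.
apply: DeriveDef => //.
rewrite derive_mx //; apply/matrixP => i k; rewrite mxE.
by have [_ ->] := entryk i k.
Qed.

End ComplexForm.

(** * Cyclic relabelling *)

Section Rotation.
Context {n : nat}.

(** The cyclic relabelling of the vortices by k places. *)
Definition add_ord (i k : 'I_n) : 'I_n :=
  Ordinal (ltn_pmod (i + k) (leq_ltn_trans (leq0n i) (ltn_ord i))).

Lemma add_ordE (i k : 'I_n) :
  nat_of_ord (add_ord i k) = if (i + k < n)%N then (i + k)%N else (i + k - n)%N.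
Proof.
rewrite /=; case: ltnP => ik; first by rewrite modn_small.
have kn := ltn_ord k; have i_n := ltn_ord i.
rewrite -{1}(subnK ik) modnDr modn_small //.
by move: (nat_of_ord i) (nat_of_ord k) kn i_n ik => *; lia.
Qed.

Lemma add_ord_inj (i : 'I_n) : injective (add_ord i).
Proof.
move=> j k /(congr1 (@nat_of_ord n)); rewrite !add_ordE => e.
apply/val_inj => /=; have := ltn_ord j; have := ltn_ord k; have := ltn_ord i.
move: (nat_of_ord i) (nat_of_ord j) (nat_of_ord k) e => x y z.
by case: (ltnP (x + y)) => h1; case: (ltnP (x + z)) => h2; lia.
Qed.

Lemma add_ord_neq (i k : 'I_n) : (add_ord i k != i) = (nat_of_ord k != 0%N).
Proof.
rewrite -val_eqE [val _]add_ordE /=; have := ltn_ord k; have := ltn_ord i.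
move: (nat_of_ord i) (nat_of_ord k) => x y xn yn.
by case: (ltnP (x + y)) => h1; congr (~~ _); apply/eqP/eqP; lia.
Qed.

Lemma theta_add (R : realType) (i k : 'I_n) : exists p : int,
  theta n (add_ord i k) = theta n i + theta n k + p%:~R * (2 * pi) :> R.
Proof.
have n0 : (n%:R : R) != 0.
  by rewrite pnatr_eq0 -lt0n (leq_ltn_trans _ (ltn_ord i)).
rewrite add_ordE; case: ltnP => ik.
  by exists 0; rewrite /theta natrD mul0r addr0 !mulrDl.
exists (-1); rewrite /theta natrB // natrD rmorphN /=.
move: pi => c; field.
by [].
Qed.

End Rotation.

Lemma sum_antisym (V : numDomainType) n (F : 'I_n -> 'I_n -> V) :
  (forall i j, F j i = - F i j) ->
  \sum_(i < n) \sum_(j < n | j != i) F i j = 0.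
Proof.
move=> Fa; set S := (LHS).
have : S = - S.
  rewrite {1}/S (exchange_big_dep xpredT) //= /S -sumrN.
  apply: eq_bigr => i _; rewrite -sumrN; apply: eq_big => [j|j _]; last exact: Fa.
  by rewrite eq_sym.
by move=> /eqP; rewrite -subr_eq0 opprK -mulr2n mulrn_eq0 => /eqP.
Qed.

(** * The motion carried by a profile *)

Section Motion.
Context {R : realType} {n : nat}.
Variables (e M : R) (pr : profile n e M).
Hypothesis e_gt0 : 0 < e.

Let Om := pr_Om pr.
Let w := pr_w pr.
Let v := pr_v pr.
Let nu : R := (2 * e ^+ 2)^-1.

Let u (s : R) : R[i] := 1 + e%:C * w s.
(** Speeds of the m-gon and of the pairs; the factor 2 pi is that of the
Hamiltonian. *)
Definition spin : R := Om / (2 * pi).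
Definition pulse : R := nu / (2 * pi).

Definition motion (j : 'I_n) (t : R) : R[i] :=
  cis (spin * t) * cis (2 * theta n j) * u (pulse * t - theta n j).

Definition motion' (j : 'I_n) (t : R) : R[i] :=
  spin%:C * 'i%C * motion j t +
  cis (spin * t) * cis (2 * theta n j) *
    (pulse%:C * (e%:C * pr_w' pr (pulse * t - theta n j))).

Let pi_neq0 : pi != 0 :> R.
Proof. by rewrite gt_eqF // pi_gt0. Qed.

Let nu_gt0 : 0 < nu.
Proof. by rewrite invr_gt0 mulr_gt0 // exprn_gt0. Qed.

Lemma u_shift (p : int) s : u (s + p%:~R * (2 * pi)) = u s.
Proof. by rewrite /u /w (periodic_shift (pr_period pr)). Qed.

Lemma cis_shift2 (p : int) (x : R) : cis (x + 2 * (p%:~R * (2 * pi))) = cis x.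
Proof.
have -> : x + 2 * (p%:~R * (2 * pi)) = x + (2 * p)%:~R * (2 * pi).
  by rewrite rmorphM /= -mulrA.
by rewrite cisD cis_int mulr1.
Qed.

Lemma motion_add i k t : motion (add_ord i k) t =
  cis (spin * t) * cis (2 * theta n i) *
  (cis (2 * theta n k) * u (pulse * t - theta n i - theta n k)).
Proof.
rewrite /motion; have [p ->] := theta_add R i k.
have -> : 2 * (theta n i + theta n k + p%:~R * (2 * pi)) =
    2 * theta n i + 2 * theta n k + 2 * (p%:~R * (2 * pi)) :> R by ring.
have -> : pulse * t - (theta n i + theta n k + p%:~R * (2 * pi)) =
    pulse * t - theta n i - theta n k + (- p)%:~R * (2 * pi).
  by rewrite rmorphN /=; ring.
by rewrite cis_shift2 u_shift cisD !mulrA.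
Qed.

Let A i t : R[i] := cis (spin * t) * cis (2 * theta n i).

Let A_conj i t : A i t * conjc (A i t) = 1.
Proof.
rewrite /A conjc_mul !conj_cis mulrACA !(mulrC (cis _) (cis (- _))) !cisN_mul.
by rewrite mulr1.
Qed.

(** Relabelling the second vortex relative to the first reduces every mutual
distance to one of the n - 1 functions of [pr_inv]. *)
Lemma motion_diff i k t : nat_of_ord k != 0%N ->
  (motion i t - motion (add_ord i k) t) *
  (conjc (A i t) * v k (pulse * t - theta n i)) = 1.
Proof.
move=> k0; rewrite motion_add /motion -/(A i t) -mulrBr.
rewrite mulrACA A_conj mul1r mulrC.
exact: (pr_inv pr).
Qed.

Lemma motion_inj t i j : i != j -> motion i t != motion j t.
Proof.
move=> ij; have [k kE] : exists k, add_ord i k = j.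
  by exists (invF (@add_ord_inj n i) j); rewrite f_invF.
rewrite -subr_eq0 -kE; apply/eqP => d0.
have k0 : nat_of_ord k != 0%N by rewrite -(add_ord_neq i) kE eq_sym.
have := motion_diff i t k0; rewrite d0 mul0r => /eqP.
by rewrite eq_sym oner_eq0.
Qed.

Lemma sum_motion_inv i t :
  \sum_(j < n | j != i) (motion i t - motion j t)^-1 =
  conjc (A i t) * \sum_(k < n | k != 0%N :> nat) v k (pulse * t - theta n i).
Proof.
rewrite (reindex_inj (@add_ord_inj n i)) /= mulr_sumr.
apply: eq_big => k; first exact: add_ord_neq.
rewrite add_ord_neq => k0.
have h := motion_diff i t k0.
have d0 : motion i t - motion (add_ord i k) t != 0.
  apply/eqP => d0; move: h; rewrite d0 mul0r => /eqP.
  by rewrite eq_sym oner_eq0.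
by apply: (mulfI d0); rewrite h mulfV.
Qed.

Lemma cderiv_motion t j : cderiv (motion j) t (motion' j t).
Proof.
have dc : cderiv (fun x => cis (spin * x)) t (spin%:C * ('i%C * cis (spin * t))).
  apply: (@cderiv_ext _ (fun x => cis (spin * x + 0))) => [x|]; first by rewrite addr0.
  rewrite -[in X in _ * X](addr0 (spin * t)); apply: (@cderiv_affine _ cis).
  exact: cderiv_cis.
have du : cderiv (fun x => u (pulse * x - theta n j)) t
    (pulse%:C * (e%:C * pr_w' pr (pulse * t - theta n j))).
  apply: (@cderiv_affine _ u).
  have := cderivD (cderiv_cst 1 (pulse * t - theta n j))
    (cderivM (cderiv_cst e%:C (pulse * t - theta n j))
      (pr_deriv pr (pulse * t - theta n j))).
  by rewrite mul0r !add0r.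
have := cderivM (cderivM dc (cderiv_cst (cis (2 * theta n j)) t)) du.
rewrite mulr0 addr0 /motion' /motion.
congr cderiv; congr (_ + _); ring.
Qed.

(** By [motion_diff] the n equations of motion are translates of the profile
equation. The choice b = 1 / (4 pi e ^ 2) makes the constants agree. *)
Lemma motion_eq t i : conjc (motion' i t) =
  - ('i%C * ((2 * pi)^-1)%:C) * \sum_(j < n | j != i) (motion i t - motion j t)^-1.
Proof.
rewrite sum_motion_inv /motion' /motion -/(A i t).
set s := pulse * t - theta n i.
have := pr_eq pr s; rewrite -/w -/Om -/(u s) -/v => eqn.
have conjE (x y c : R) (z1 z2 z3 : R[i]) :
    conjc (x%:C * 'i%C * (z1 * z2) + z1 * (y%:C * (c%:C * z3))) =
    x%:C * - 'i%C * (conjc z1 * conjc z2) + conjc z1 * (y%:C * (c%:C * conjc z3)).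
  by rewrite conjc_add !conjc_mul !conjc_real conjc_i.
rewrite conjE; have {}eqn : conjc (pr_w' pr s) =
    - 'i%C * ((2 * e)%:C * (\sum_(k < n | k != 0%N :> nat) v k s - Om%:C * conjc (u s))).
  by rewrite -eqn mulrA mulNr -expr2 sqr_i opprK mul1r.
rewrite eqn.
set S := \sum_(k < n | _) _; set a := conjc (A i t); set U := conjc (u s).
have pE : pulse%:C * e%:C * (2 * e)%:C = ((2 * pi)^-1)%:C :> R[i].
  rewrite -!rmorphM /=; congr (_%:C); rewrite /pulse /nu.
  have e0 : e != 0 by rewrite gt_eqF.
  by move: pi pi_neq0 => c c0; field; rewrite ?c0 ?e0.
have sE : spin%:C = Om%:C * ((2 * pi)^-1)%:C :> R[i] by rewrite -rmorphM.
rewrite sE.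
have -> : a * (pulse%:C * (e%:C * (- 'i%C * ((2 * e)%:C * (S - Om%:C * U))))) =
   (pulse%:C * e%:C * (2 * e)%:C) * (- 'i%C * a * (S - Om%:C * U)) by ring.
by rewrite pE; ring.
Qed.

Lemma motion_solution : vortex_solution (plane motion).
Proof.
exact: (vortex_solutionP motion_inj cderiv_motion motion_eq).
Qed.

(** The forces are antisymmetric. *)
Lemma sum_motion_cst t t' : \sum_(j < n) motion j t = \sum_(j < n) motion j t'.
Proof.
move: t t'; apply: cderiv0_cst => t.
have := cderiv_sum (index_enum 'I_n) (cderiv_motion t).
suff -> : \sum_(j < n) motion' j t = 0 by [].
rewrite -[LHS]conjcK (conjc_sum (index_enum _)).
under eq_bigr do rewrite motion_eq.
rewrite -mulr_sumr sum_antisym ?mulr0 ?conjc0 // => i j.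
by rewrite -opprB invrN.
Qed.

(** The derivative is twice the real part of the sum of the z_i conj (z_i').
Up to a purely imaginary factor this is the sum S of the z_i / (z_i - z_j)
over i != j. Exchanging i and j gives 2 S = n (n - 1), so S is real. *)
Lemma inertia_motion_cst : exists c, forall t, inertia (plane motion t) = c.
Proof.
pose Q t := \sum_(j < n) motion j t * conjc (motion j t).
have QE t : inertia (plane motion t) = Re (Q t).
  rewrite /inertia /Q; elim/big_rec2: _ => // j x y _ ->.
  rewrite cRe_add plane_Re plane_Im; congr (_ + _).
  by case: (motion j t) => a b /=; rewrite mulrN opprK !expr2.
have Qc : forall t s, Q t = Q s.
  apply: cderiv0_cst => t.
  have := cderiv_sum (index_enum 'I_n)
    (fun j => cderivM (cderiv_motion t j) (cderiv_conj (cderiv_motion t j))).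
  suff -> : \sum_(j < n) (motion' j t * conjc (motion j t) +
     motion j t * conjc (motion' j t)) = 0 by [].
  pose c : R[i] := 'i%C * ((2 * pi)^-1)%:C.
  pose S := \sum_(i < n) \sum_(j < n | j != i) motion i t / (motion i t - motion j t).
  have PE : \sum_(j < n) motion j t * conjc (motion' j t) = - c * S.
    rewrite mulr_sumr; apply: eq_bigr => i _; rewrite motion_eq mulrCA; congr (_ * _).
    by rewrite mulr_sumr.
  have cc : conjc c = - c by rewrite conjc_mul conjc_i conjc_real mulNr.
  have S2 : S + S = \sum_(i < n) \sum_(j < n | j != i) 1.
    rewrite {2}/S (exchange_big_dep xpredT) //= -big_split; apply: eq_bigr => i _ /=.
    have -> : \sum_(j < n | i != j) motion j t / (motion j t - motion i t) =
        \sum_(j < n | j != i) motion j t / (motion j t - motion i t).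
      by apply: eq_bigl => j; rewrite eq_sym.
    rewrite -big_split; apply: eq_bigr => j ji /=.
    rewrite -[motion j t - motion i t]opprB invrN mulrN -mulrBl mulfV //.
    by rewrite subr_eq0 motion_inj // eq_sym.
  have S_real : conjc S = S.
    have : conjc S + conjc S = S + S.
      rewrite -conjc_add S2 (conjc_sum (index_enum _)); apply: eq_bigr => i _.
      rewrite -[LHS]/(conjc _) (rmorph_sum (@conjc R)); apply: eq_bigr => j _.
      exact: conjc1.
    move=> h; apply: (@mulfI _ 2); first by rewrite pnatr_eq0.
    by rewrite !mulr2n !mulrDl !mul1r.
  rewrite big_split /= PE.
  have -> : \sum_(j < n) motion' j t * conjc (motion j t) = conjc (- c * S).
    rewrite -PE (conjc_sum (index_enum _)); apply: eq_bigr => i _.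
    by rewrite [RHS]conjc_mul conjcK mulrC.
  have ccN : conjc (- c) = c.
    by rewrite conjc_opp cc opprK.
  by rewrite conjc_mul S_real ccN mulNr addrN.
exists (Re (Q 0)) => t; by rewrite QE (Qc t 0).
Qed.

(** The time after which, up to a rotation, each vortex takes the place of the
next one. *)
Definition delay : R := theta n 1 / pulse.

Lemma pulse_gt0 : 0 < pulse.
Proof. by rewrite divr_gt0 // mulr_gt0 // pi_gt0. Qed.

Hypothesis n_gt3 : (3 < n)%N.

Let one_ord : 'I_n := Ordinal (ltn_trans (isT : 1 < 3)%N n_gt3).

Definition turn : R[i] := cis (spin * delay + 2 * theta n 1).

Lemma pulse_delay t s : pulse * (t + s / pulse) = pulse * t + s.
Proof. by rewrite mulrDr mulrCA mulfV ?mulr1 // gt_eqF // pulse_gt0. Qed.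

Lemma motion_delay j t : motion (add_ord one_ord j) (t + delay) = turn * motion j t.
Proof.
rewrite motion_add /= pulse_delay mulrDr /turn !cisD /motion.
have -> : pulse * t + theta n 1 - theta n 1 - theta n j = pulse * t - theta n j :> R.
  by ring.
by ring.
Qed.

Lemma motion_period j t : motion j (t + n%:R * delay) =
  cis (spin * (n%:R * delay)) * motion j t.
Proof.
have n0 : (n%:R : R) != 0 by rewrite pnatr_eq0 -lt0n (ltn_trans _ n_gt3).
have -> : n%:R * delay = (2 * pi) / pulse.
  by rewrite /delay /theta mulrA mul1r (mulrC n%:R) divfK.
rewrite /motion pulse_delay (mulrDr spin) (cisD (spin * t)).
have -> : pulse * t + 2 * pi - theta n j = pulse * t - theta n j + 1%:~R * (2 * pi).
  by rewrite mul1r; ring.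
by rewrite u_shift; ring.
Qed.

Hypothesis slow : M * e ^+ 2 < 1.

(** The angle is 2 theta_1 (1 + Om e ^ 2), which lies strictly between 0 and
4 theta_1; the latter is at most 2 pi because n >= 4. *)
Lemma turn_neq1 : turn != 1.
Proof.
have p0 := @pi_gt0 R.
have n0 : 0 < n%:R :> R by rewrite ltr0n (ltn_trans _ n_gt3).
have dE : spin * delay = Om * e ^+ 2 * (2 * theta n 1).
  rewrite /spin /delay /pulse /nu; have e0 : e != 0 by rewrite gt_eqF.
  by move: (theta n 1) pi pi_neq0 => th c c0; field; rewrite ?c0 ?e0.
have Om1 : `|Om * e ^+ 2| < 1.
  rewrite normrM (ger0_norm (sqr_ge0 e)); apply: le_lt_trans slow.
  by rewrite ler_wpM2r ?sqr_ge0 // pr_Om_le.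
have /andP[th0 _] : 0 < (theta n 1 : R) < 2 * pi.
  by apply: theta_lt => //; exact: ltn_trans n_gt3.
have th1 : theta n 1 * n%:R = 2 * pi :> R.
  by rewrite /theta mul1r divfK // gt_eqF.
have n4 : 4 <= n%:R :> R by rewrite (ler_nat _ 4).
rewrite /turn dE; apply: cis_neq1; move: Om1; set x := Om * _.
rewrite ltr_norml => /andP[x1 x2].
move: (theta n 1) th0 th1 => th th0 th1.
have th2 : 4 * th <= 2 * pi by rewrite -th1 mulrC ler_wpM2l // ltW.
apply/andP; split; nra.
Qed.

End Motion.

Arguments delay {R} n e.

Local Open Scope quotient_scope.

(** * Reduction to projective space *)

Section Projective.
Context {R : realType} {n : nat}.
Variable f : 'M[R[i]]_n.
Hypothesis f_red : reducing_unitary f.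
Implicit Types Z : 'M[R]_(n, 2).

Let f_unit : f \in unitmx.
Proof. by case: f_red => /unitarymx_unit. Qed.

(** A point of the projective space determines the centred configuration up to
a complex factor. *)
Lemma projects_to_inj Z Z' (p : projspace R n.-1) :
  projects_to f Z p -> projects_to f Z' p ->
  exists2 c : R[i], c != 0 & cplx Z = c *: cplx Z'.
Proof.
move=> [w [wE ->]] [w' [w'E /eqmodP/proj_equivP[c c0 ww']]].
exists c => //; rewrite -[LHS](mulKmx f_unit) wE ww' append0Z -w'E.
by rewrite -scalemxAr mulKmx.
Qed.

Lemma centred_sum Z : centred Z -> \sum_j cplx Z j 0 = 0.
Proof.
move=> /rowP cZ; apply/eqP; rewrite eq_complex.
have ReS : Re (\sum_j cplx Z j 0) = \sum_j Z j 0.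
  by elim/big_rec2: _ => // j x y _ <-; rewrite cRe_add mxE.
have ImS : Im (\sum_j cplx Z j 0) = \sum_j Z j 1.
  by elim/big_rec2: _ => // j x y _ <-; rewrite cIm_add mxE.
have := cZ 0; have := cZ 1; rewrite !summxE ReS ImS !mxE.
under eq_bigr do rewrite mxE; move=> ->.
under eq_bigr do rewrite mxE; move=> ->.
by rewrite !eqxx.
Qed.

Definition reduced_coords Z : 'cV[R[i]]_n.-1 := drop_last (f *m cplx Z).

Lemma append0_reduced_coords Z : centred Z -> append0 (reduced_coords Z) = f *m cplx Z.
Proof.
move=> cZ; apply: drop_lastK => i iE.
by rewrite (reducing_unitary_last _ f_red iE) centred_sum // mulr0.
Qed.

Lemma reduced_coords_neq0 Z : centred Z -> cplx Z != 0 -> reduced_coords Z != 0.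
Proof.
move=> cZ; apply: contra => /eqP s0; apply/eqP.
rewrite -[LHS](mulKmx f_unit) -append0_reduced_coords // s0.
by rewrite -(scale0r 0) append0Z scale0r mulmx0.
Qed.

Definition proj_point Z (ZP : reduced_coords Z \in @nonzero_set R n.-1) : projspace R n.-1 :=
  \pi_(projspace R n.-1) (exist _ (reduced_coords Z) ZP : @nonzero_set R n.-1).

Lemma projects_to_point Z (ZP : reduced_coords Z \in @nonzero_set R n.-1) :
  centred Z -> projects_to f Z (proj_point ZP).
Proof.
by move=> cZ; exists (exist _ (reduced_coords Z) ZP); rewrite append0_reduced_coords.
Qed.

Lemma cvg_complex (g : R -> R[i]) t d : cderiv g t d ->
  (g x : R[i]^o) @[x --> t] --> (g t : R[i]^o).
Proof.
move=> [d1 d2].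
have c1 : {for t, continuous (fun x => Re (g x))}.
  by apply/differentiable_continuous/derivable1_diffP; case: d1.
have c2 : {for t, continuous (fun x => Im (g x))}.
  by apply/differentiable_continuous/derivable1_diffP; case: d2.
apply/cvgrPdist_lt => /= eps; case: eps => e1 e2.
rewrite ltcE /= => /andP[/eqP -> e0].
have e20 : 0 < e1 / 2 by rewrite divr_gt0.
move/cvgrPdist_lt : c1 => /(_ _ e20) h1.
move/cvgrPdist_lt : c2 => /(_ _ e20) h2.
near=> x.
have x1 : `|Re (g t) - Re (g x)| < e1 / 2 by near: x.
have x2 : `|Im (g t) - Im (g x)| < e1 / 2 by near: x.
have -> : g t - g x = (Re (g t) - Re (g x))%:C + 'i%C * (Im (g t) - Im (g x))%:C.
  rewrite [LHS]complexE; congr ((_)%:C + 'i%C * (_)%:C).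
    by case: (g t) (g x) => [? ?] [].
  by case: (g t) (g x) => [? ?] [].
have i1 : `|'i%C| = 1 :> R[i].
  by rewrite normc_def /= expr0n add0r expr1n sqrtr1.
have nR (y : R) : `|y%:C| = `|y|%:C :> R[i].
  by rewrite normc_def /= expr0n addr0 sqrtr_sqr.
apply: le_lt_trans (ler_normD _ _) _.
rewrite normrM i1 mul1r !nR -rmorphD /= ltcR; lra.
Unshelve. all: by end_near.
Qed.

Lemma continuous_proj_point (Z : R -> 'M[R]_(n, 2))
    (ZP : forall t, reduced_coords (Z t) \in @nonzero_set R n.-1)
    (z' : 'I_n -> R -> R[i]) :
  (forall j t, cderiv (fun x => cplx (Z x) j 0) t (z' j t)) ->
  continuous (fun t => proj_point (ZP t)).
Proof.
move=> dz.
pose v t : @nonzero_set R n.-1 := exist _ (reduced_coords (Z t)) (ZP t).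
have reduced_coords_cvg t (P : set 'cV[R[i]^o]_n.-1) : nbhs (reduced_coords (Z t) : 'cV[R[i]^o]_n.-1) P ->
    \forall x \near t, P (reduced_coords (Z x)).
  move=> [Q nQ QP].
  have : \forall x \near t, forall ij : 'I_n.-1 * 'I_1,
      Q ij.1 ij.2 (reduced_coords (Z x) ij.1 ij.2).
    apply: (@filter_forall R ('I_n.-1 * 'I_1)%type (fun ij x =>
      Q ij.1 ij.2 (reduced_coords (Z x) ij.1 ij.2)) (nbhs t) _) => -[i j] /=.
    have dE : cderiv (fun x => reduced_coords (Z x) i j) t
        (\sum_l f (widen_ord (leq_pred n) i) l * z' l t).
      apply: (@cderiv_ext _ (fun x => \sum_l f (widen_ord (leq_pred n) i) l *
          cplx (Z x) l 0)).
        by move=> x; rewrite !mxE.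
      apply: cderiv_sum => l.
      have := cderivM (cderiv_cst (f (widen_ord (leq_pred n) i) l) t) (dz l t).
      by rewrite mul0r add0r.
    exact: (cvg_complex dE (nQ i j)).
  by apply: filterS => x hx; apply: QP => i j; exact: (hx (i, j)).
have cv : continuous v.
  move=> t U [_ /= [[W oW <-]]] /= Wv WU.
  exact: (filterS (fun x => WU (v x)) (reduced_coords_cvg t W (open_nbhs_nbhs (conj oW Wv)))).
move=> t; apply: (@continuous_comp _ _ _ v (\pi_(projspace R n.-1))).
  exact: cv.
exact: pi_continuous.
Qed.

End Projective.

(** * Tight pairs are relative choreographies *)

Section Choreography.
Context {R : realType} {n : nat}.
Variables (e M : R) (pr : profile n e M).
Hypothesis e_gt0 : 0 < e.
Hypothesis e_le1 : e <= 1.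
Hypothesis n_gt3 : (3 < n)%N.
Hypothesis n_even : ~~ odd n.
Hypothesis slow : M * e ^+ 2 < 1.

Local Notation z := (motion pr).
Local Notation Z := (plane z).

Let ord1n : 'I_n := Ordinal (ltn_trans (isT : 1 < 3)%N n_gt3).
Let ord0n : 'I_n := Ordinal (ltn_trans (isT : 0 < 3)%N n_gt3).
Let n_gt0 : (0 < n)%N := ltn_trans (isT : 0 < 3)%N n_gt3.
Let mid : 'I_n := half_ord n_gt0.

(** The sum is constant, and the relabelling after a delay multiplies it by
[turn], which is not 1. *)
Lemma sum_motion_eq0 t : \sum_(j < n) z j t = 0.
Proof.
have sE : \sum_(j < n) z j (t + delay n e) = turn pr * \sum_(j < n) z j t.
  rewrite (reindex_inj (@add_ord_inj n ord1n)) mulr_sumr; apply: eq_bigr => j _.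
  exact: motion_delay.
rewrite (sum_motion_cst pr e_gt0 _ t) in sE.
have t1 := turn_neq1 pr e_gt0 n_gt3 slow.
apply/eqP; have : (1 - turn pr) * \sum_(j < n) z j t = 0.
  by rewrite mulrBl mul1r -sE subrr.
by move/eqP; rewrite mulf_eq0 subr_eq0 eq_sym (negPf t1).
Qed.

Lemma cplx_plane t j : cplx (Z t) j 0 = z j t.
Proof. by rewrite !mxE /=; case: (z j t). Qed.

Lemma centred_motion t : centred (Z t).
Proof.
have s0 := sum_motion_eq0 t.
apply/rowP => k; rewrite summxE !mxE.
under eq_bigr do rewrite !mxE.
case: (k == 0).
  rewrite -[RHS]/(Re 0) -s0; elim/big_rec2: _ => // j x y _ ->.
  by rewrite cRe_add.
rewrite -[RHS]/(Im 0) -s0; elim/big_rec2: _ => // j x y _ ->.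
by rewrite cIm_add.
Qed.

Lemma cplx_motion_neq0 t : cplx (Z t) != 0.
Proof.
apply/eqP => /colP c0.
have := @motion_inj _ _ _ _ pr t ord0n ord1n isT.
by rewrite -!cplx_plane !c0 !mxE eqxx.
Qed.

(** The vortices 0 and n / 2 form the pair near the vertex 1 of the m-gon. *)
Lemma ord0nE t : z ord0n t = cis (spin pr * t) * (1 + e%:C * pr_w pr (pulse e * t)).
Proof. by rewrite /motion theta0 mulr0 cis0 mulr1 subr0. Qed.

Lemma midE t : z mid t = cis (spin pr * t) * (1 + e%:C * pr_w pr (pulse e * t - pi)).
Proof. by rewrite /motion /= theta_half // cis_2pi mulr1. Qed.

Let rest s := pr_w pr s - cis s.

Lemma pair_sum t : exists2 D : R[i], cnorm (D - 2) <= e / 4 &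
  z ord0n t + z mid t = cis (spin pr * t) * D.
Proof.
set s := pulse e * t.
exists (2 + e%:C * (rest s + rest (s - pi))).
  rewrite addrC addKr; apply: le_trans (cnormM _ _) _.
  rewrite cnorm_real gtr0_norm //; apply: ler_wpM2l; first exact: ltW.
  apply: le_trans (cnormD _ _) _.
  by have := pr_close pr s; have := pr_close pr (s - pi); rewrite -/(rest _); lra.
rewrite ord0nE midE /rest -/s cisD -conj_cis cis_pi rmorphN1 mulrN1.
by ring.
Qed.

Lemma pair_diff t : exists2 N : R[i], 7 / 4 <= cnorm N <= 17 / 4 &
  z ord0n t - z mid t = cis (spin pr * t) * (e%:C * N).
Proof.
set s := pulse e * t.
pose r := rest s - rest (s - pi).
have rle : cnorm r <= 1 / 4.
  apply: le_trans (cnormB _ _) _.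
  by have := pr_close pr s; have := pr_close pr (s - pi); rewrite -/(rest _); lra.
have c2 := cnorm_double (cis s).
exists (2 * cis s + r).
  have := cnorm_cis_ge1 s; have := cnorm_cis_le2 s.
  have := cnormD (2 * cis s) r; have := cnormB (2 * cis s + r) r.
  by rewrite addrK c2 => *; apply/andP; split; lra.
rewrite ord0nE midE /r /rest -/s cisD -conj_cis cis_pi rmorphN1 mulrN1.
by ring.
Qed.

(** The difference inside the pair is 2 e cis s up to a relative error 1 / 8
and the sum is close to 2, so the ratio has size comparable to e. *)
Lemma pair_ratio t : exists q : R[i],
  [/\ z ord0n t - z mid t = q * (z ord0n t + z mid t),
      z ord0n t + z mid t != 0, e / 2 <= cnorm q & cnorm q <= 3 * e].
Proof.
have [D Dl DE] := pair_sum t; have [N /andP[N1 N2] NE] := pair_diff t.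
have D0 : D != 0.
  apply/eqP => D0; move: Dl; rewrite D0 sub0r cnormN -[2]mulr1 cnorm_double cnorm1 => h.
  by move: e_le1; lra.
exists (e%:C * N / D).
have qD : e%:C * N / D * D = e%:C * N by rewrite divfK.
set q := e%:C * N / D in qD *.
have n2 := @cnorm_double R.
have eN : cnorm (e%:C * N) = e * cnorm N by rewrite cnorm_realM gtr0_norm.
split.
- by rewrite NE DE -qD mulrCA.
- by rewrite DE mulf_neq0 // cis_neq0.
- have h : cnorm D <= 9 / 4.
    have c2 : cnorm (2 : R[i]) = 2 by rewrite -[2]mulr1 n2 cnorm1 mulr1.
    have := cnormD (D - 2) 2; rewrite subrK c2.
    by move: e_le1; lra.
  have := cnormM q D; rewrite qD eN => h2.
  have := ler_wpM2l (cnorm_ge0 q) h.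
  by have := ler_wpM2l (ltW e_gt0) N1; move: e_gt0; lra.
- have qE : 2 * q = e%:C * N - q * (D - 2) by rewrite mulrBr qD; ring.
  have := cnormB (e%:C * N) (q * (D - 2)); rewrite -qE n2 eN => h.
  have := cnormM q (D - 2) => h2.
  have := ler_wpM2l (cnorm_ge0 q) Dl.
  have := ler_wpM2l (cnorm_ge0 q) e_le1.
  by have := ler_wpM2l (ltW e_gt0) N2; move: e_gt0 (cnorm_ge0 q); lra.
Qed.

Variable f : 'M[R[i]]_n.
Hypothesis f_red : reducing_unitary f.

Lemma reduced_coords_motion t : reduced_coords f (Z t) \in @nonzero_set R n.-1.
Proof.
apply/mem_set; apply: reduced_coords_neq0 => //; first exact: centred_motion.
exact: cplx_motion_neq0.
Qed.

(** Non-triviality: after half a turn of the pair the vortices 0 and n / 2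
have exchanged their places up to a rotation. If the projective point were
constant, the factor c would multiply z_0 + z_(n/2) by 1, hence the two
vortices would coincide. *)
Lemma motion_choreography : nontrivial_centred_relative_choreography f Z.
Proof.
pose T := n%:R * delay n e.
have n0 : (n%:R : R) != 0 by rewrite pnatr_eq0 -lt0n.
have proj t := projects_to_point f_red (reduced_coords_motion t) (centred_motion t).
pose W t := proj_point (reduced_coords_motion t).
exists T, W; split; first split.
- rewrite mulr_gt0 ?ltr0n // divr_gt0 ?pulse_gt0 //.
  have /andP[] // : 0 < (theta n 1 : R) < 2 * pi.
  by apply: theta_lt => //; exact: ltn_trans n_gt3.
- apply: (@continuous_proj_point _ _ f Z reduced_coords_motion (motion' pr)) => j t.
  apply: (@cderiv_ext _ (z j)); last exact: cderiv_motion.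
  by move=> x; rewrite cplx_plane.
- move=> t; apply/eqmodP/proj_equivP.
  exists (cis (spin pr * T)); first exact: cis_neq0.
  rewrite /= /reduced_coords.
  have -> : cplx (Z (t + T)) = cis (spin pr * T) *: cplx (Z t).
    by apply/colP => j; rewrite [RHS]mxE !cplx_plane motion_period.
  by rewrite -scalemxAr; apply/colP => i; rewrite !mxE.
- move=> t; rewrite (_ : T / n%:R = delay n e); last by rewrite /T mulrC mulKf.
  have nz : sigma2_lift f (reduced_coords f (Z t)) \in @nonzero_set R n.-1.
    apply/mem_set; apply: sigma2_lift_neq0 => //.
    by have /set_mem := reduced_coords_motion t.
  pose v : @nonzero_set R n.-1 :=
    exist _ (sigma2_lift f (reduced_coords f (Z t))) nz.
  rewrite /W /proj_point (@sigma2_piE _ _ _ _ v) //; last exact: sigma2_liftE.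
  apply/eqmodP/proj_equivP; exists (turn pr); first exact: cis_neq0.
  rewrite /= /reduced_coords /sigma2_lift -/(reduced_coords f (Z t)).
  rewrite (append0_reduced_coords f_red (centred_motion t)) mulKmx; last first.
    by case: f_red => /unitarymx_unit.
  have -> : cplx (Z (t + delay n e)) = turn pr *: cyclic_shift (cplx (Z t)).
    apply/colP => j; rewrite [RHS]mxE [cyclic_shift _ j 0]mxE !cplx_plane.
    rewrite -(motion_delay pr e_gt0 n_gt3); congr motion.
    by rewrite -[LHS]ord_predK; exact/val_inj.
  by rewrite -scalemxAr; apply/colP => i; rewrite !mxE.
- move=> [p Wp].
  pose h := pi / pulse e.
  (* h is the time of half a turn of the pair. *)
  have [c c0 cE] : exists2 c : R[i], c != 0 & cplx (Z 0) = c *: cplx (Z (0 + h)).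
    apply: (projects_to_inj f_red (p := p)); [rewrite -(Wp 0)|rewrite -(Wp (0 + h))];
    exact: proj.
  have e0 : z ord0n 0 = c * z ord0n (0 + h).
    by rewrite -!cplx_plane {1}cE mxE.
  have e1 : z mid 0 = c * z mid (0 + h).
    by rewrite -!cplx_plane {1}cE mxE.
  pose k := cis (spin pr * h).
  have ph : pulse e * (0 + h) = pi by rewrite pulse_delay // mulr0 add0r.
  have h0 : z ord0n (0 + h) = k * z mid 0.
    rewrite ord0nE midE ph !mulr0 add0r cis0 mul1r /k add0r; congr (_ * (1 + _ * _)).
    rewrite -(periodic_shift (pr_period pr) 1 (- pi)) mul1r.
    by congr pr_w; ring.
  have h1 : z mid (0 + h) = k * z ord0n 0.
    by rewrite midE ord0nE ph !mulr0 cis0 mul1r subrr /k add0r.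
  have [q [_ s0 _ _]] := pair_ratio 0.
  have ck : c * k = 1.
    apply: (mulIf s0); rewrite mul1r mulrDr -!mulrA -h0 -h1 -e0 -e1.
    by rewrite addrC.
  have := @motion_inj _ _ _ _ pr 0 ord0n mid; rewrite e0 h0 mulrA ck mul1r eqxx.
  have -> : ord0n != mid by rewrite eq_sym -val_eqE /=; exact: half_ord_neq0.
  by move=> /(_ isT).
- split.
  + exact: centred_motion.
  + exact: inertia_motion_cst.
  + exact: proj.
Qed.

End Choreography.

(** The ratio q is a projective invariant of the configuration that recovers e
up to a factor 6; it is what tells the solutions apart. *)
Lemma tight_pair_choreography (R : realType) (n : nat) (f : 'M[R[i]]_n) :
  ~~ odd n -> (2 < n)%N -> reducing_unitary f ->
  exists2 e0 : R, 0 < e0 & forall e, 0 < e -> e <= e0 ->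
    exists Z : R -> 'M[R]_(n, 2),
      [/\ vortex_solution Z, nontrivial_centred_relative_choreography f Z &
        exists i j : 'I_n, [/\ nat_of_ord i = 0%N, nat_of_ord j = n./2 &
        forall t, exists q : R[i],
          [/\ cplx (Z t) i 0 - cplx (Z t) j 0 = q * (cplx (Z t) i 0 + cplx (Z t) j 0),
              cplx (Z t) i 0 + cplx (Z t) j 0 != 0,
              e / 2 <= cnorm q & cnorm q <= 3 * e]]].
Proof.
move=> ne n2 f_red; have n3 : (3 < n)%N.
  by rewrite ltn_neqAle n2 andbT; apply: contraNneq ne => <-.
have n0 : (0 < n)%N by exact: ltn_trans n2.
have [e0 [M [e0_gt0 M0 prof]]] := @profile_exists R n ne n0.
(* e <= 1 / (M + 1) gives both e <= 1 and M e ^ 2 < 1. *)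
pose e1 := Num.min e0 (M + 1)^-1.
have M1 : 0 < M + 1 by rewrite ltr_wpDl.
exists e1; first by rewrite lt_min e0_gt0 invr_gt0.
move=> e e_gt0; rewrite le_min => /andP[ee0 eM].
have [pr] := prof e e_gt0 ee0.
have eM1 : e * (M + 1) <= 1 by rewrite -ler_pdivlMr // mul1r.
have e_le1 : e <= 1.
  by have := mulr_ge0 (ltW e_gt0) M0; lra.
have slow : M * e ^+ 2 < 1 by nra.
exists (plane (motion pr)); split.
- exact: motion_solution.
- exact: motion_choreography.
- exists (Ordinal (ltn_trans (isT : 0 < 3)%N n3)),
    (half_ord (ltn_trans (isT : 0 < 3)%N n3)); split => // t.
  have [q [h1 h2 h3 h4]] := pair_ratio pr e_gt0 e_le1 n3 ne t.
  by exists q; rewrite !cplx_plane.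
Qed.

Theorem theorem3p1 (R : realType) (n : nat) (n_even : ~~ odd n)
    (n_gt2 : (2 < n)%N) (f : 'M[R[i]]_n) (f_red : reducing_unitary f) :
  infinite_set (reduced_trajectory f @`
    [set Z : R -> 'M[R]_(n, 2) |
      vortex_solution Z /\ nontrivial_centred_relative_choreography f Z]).
Proof.
have [e0 e0_gt0 sol] := tight_pair_choreography n_even n_gt2 f_red.
(* The invariant q lies in [e / 2, 3 e], so a ratio larger than 6 between
   successive sizes separates the solutions. *)
pose e (k : nat) : R := e0 * 10^-1 ^+ k.
have e_gt0 k : 0 < e k by rewrite mulr_gt0 // exprn_gt0 // invr_gt0.
have e_le k : e k <= e0.
  rewrite /e ler_piMr ?(ltW e0_gt0) // exprn_ile1 //.
  by rewrite invf_le1 // ler1n.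
have [Z ZP] := choice (fun k => sol (e k) (e_gt0 k) (e_le k)).
have Zinj k l : (k < l)%N ->
    reduced_trajectory f (Z k) <> reduced_trajectory f (Z l).
  move=> kl same; have [_ [T [w [_ _ [_ _ wk]]]] [i [j [i0 jn rk]]]] := ZP k.
  have [_ _ [i' [j' [i0' jn' rl]]]] := ZP l.
  have ii' : i' = i by apply/val_inj; rewrite /= i0 i0'.
  have jj' : j' = j by apply/val_inj; rewrite /= jn jn'.
  rewrite {}ii' {}jj' {i0' jn'} in rl.
  have : reduced_trajectory f (Z k) (w 0) by exists 0; exact: wk.
  rewrite same => -[t wl].
  have [c c0 cE] := projects_to_inj f_red (wk 0) wl.
  have [q [q1 q2 q3 _]] := rk 0; have [r [r1 r2 _ r4]] := rl t.
  have qr : q = r.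
    have cEx x : cplx (Z k 0) x 0 = c * cplx (Z l t) x 0 by rewrite cE [LHS]mxE.
    by apply: (mulIf q2); rewrite -q1 !cEx -mulrBr r1 -mulrDr mulrCA.
  have : e l <= e k / 10.
    rewrite /e -mulrA ler_wpM2l ?(ltW e0_gt0) // -exprSr.
    by rewrite ler_wiXn2l // invf_le1 // ler1n.
  by have := e_gt0 k; rewrite qr in q3; lra.
have injZ : injective (fun k => reduced_trajectory f (Z k)).
  move=> k l same; have [kl|lk|//] := ltngtP k l.
    by case: (Zinj _ _ kl same).
  by case: (Zinj _ _ lk (esym same)).
move=> fin; apply: infinite_nat.
have inj : {in (fun k => reduced_trajectory f (Z k)) @^-1` (reduced_trajectory f @`
    [set Z : R -> 'M[R]_(n, 2) |
      vortex_solution Z /\ nontrivial_centred_relative_choreography f Z]) &,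
    injective (fun k => reduced_trajectory f (Z k))}.
  by move=> k l _ _; exact: injZ.
apply: sub_finite_set (finite_preimage inj fin) => k _.
by exists (Z k) => //; have [] := ZP k.
Qed.
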